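(* Let $\varepsilon\in(0,1)$ and $c>9/\varepsilon^2$ be constants, and let $p=p(n)\geq c\ln(n)/n$. Let $G=(V,E)$ be a random graph drawn from the Erdős–Rényi model $G(n,p)$ (with $n$ even), and consider the corresponding random shortest path metric on $G$. Let $\mathsf{GR}$ be the cost of the perfect matching computed by the greedy matching heuristic and $\mathsf{MM}$ the cost of a minimum-distance perfect matching in this metric. Then, as $n\to\infty$, \[\mathbb{E}\left[\frac{\mathsf{GR}}{\mathsf{MM}}\right]=O(1),\] where the expectation is taken over both the random graph and the random edge weights.
   Context: Erdős–Rényi model $G(n,p)$: vertex set $\{1,\dots,n\}$, each pair of vertices joined by an edge independently with probability $p$. Random shortest path metric on a graph $G=(V,E)$: each edge $e\in E$ independently receives a weight $w(e)\sim\mathrm{Exp}(1)$ (exponential with parameter 1), and for $u,v\in V$, $d(u,v)$ is the minimum total weight of a $u$–$v$ path in $G$, with $d(u,v)=\infty$ if no such path exists (this still satisfies the metric axioms, allowing the value $\infty$). The instance is the complete graph on $V$ with distances $d$. Greedy matching heuristic: repeatedly add to the matching a pair of currently unmatched vertices whose distance $d$ is minimum, until all vertices are matched; the cost of a matching is the sum of $d(u,v)$ over matched pairs. *)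

(* Defs.v *)
From HB Require Import structures.
From mathcomp Require Import all_boot all_order all_algebra.
From mathcomp Require Import all_classical all_reals all_analysis.

Set Implicit Arguments.
Unset Strict Implicit.
Unset Printing Implicit Defensive.

Import Order.TTheory GRing.Theory Num.Theory.
Import numFieldNormedType.Exports.

Local Open Scope classical_set_scope.
Local Open Scope ring_scope.

(* An unordered pair {u, v} of distinct vertices is encoded as the ordered pair
   (u, v) with u < v. *)
Definition pairs (n : nat) : {set 'I_n * 'I_n} :=
  [set e : 'I_n * 'I_n | (e.1 < e.2)%N]%SET.

Definition upair (n : nat) (u v : 'I_n) : 'I_n * 'I_n :=
  if (u < v)%N then (u, v) else (v, u).

(* For E \subset pairs n there are no loops, since upair u u = (u, u). *)
Definition adj (n : nat) (E : {set 'I_n * 'I_n}) : rel 'I_n :=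
  fun u v => upair u v \in E.

Definition path_weight (R : realType) (n : nat) (w : 'I_n * 'I_n -> R)
    (u : 'I_n) (s : seq 'I_n) : R :=
  \sum_(x <- pairmap (fun a b => w (upair a b)) u s) x.

(* The infimum ranges over a finite set (simple paths), hence is a minimum as
   soon as u and v are connected; it is +oo otherwise. *)
Definition sp_dist (R : realType) (n : nat) (E : {set 'I_n * 'I_n})
    (w : 'I_n * 'I_n -> R) (u v : 'I_n) : \bar R :=
  ereal_inf [set (path_weight w u s)%:E |
    s in [set s : seq 'I_n |
           [&& path (adj E) u s, last u s == v & uniq (u :: s)]]].

Definition perfect_matching (n : nat) (M : {set 'I_n * 'I_n}) : bool :=
  (M \subset pairs n) &&
  [forall v, #|[set e in M | (e.1 == v) || (e.2 == v)]%SET| == 1%N].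

Definition matching_cost (R : realType) (n : nat) (d : 'I_n -> 'I_n -> \bar R)
    (M : {set 'I_n * 'I_n}) : \bar R :=
  (\sum_(e in M) d e.1 e.2)%E.

Definition min_matching_cost (R : realType) (n : nat)
    (d : 'I_n -> 'I_n -> \bar R) : \bar R :=
  ereal_inf [set matching_cost d M |
    M in [set M : {set 'I_n * 'I_n} | perfect_matching M]].

Definition unmatched (n : nat) (M : {set 'I_n * 'I_n}) (v : 'I_n) : bool :=
  [forall e in M, (e.1 != v) && (e.2 != v)].

Definition free_pairs (n : nat) (M : {set 'I_n * 'I_n}) : {set 'I_n * 'I_n} :=
  [set e in pairs n | unmatched M e.1 && unmatched M e.2]%SET.

(* The partial matchings reachable by the greedy heuristic; a relation because
   ties between closest pairs may be broken arbitrarily. *)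
Inductive greedy_run (R : realType) (n : nat) (d : 'I_n -> 'I_n -> \bar R) :
    {set 'I_n * 'I_n} -> Prop :=
| greedy_start : greedy_run d finset.set0
| greedy_add M e : greedy_run d M -> e \in free_pairs M ->
    (forall f, f \in free_pairs M -> (d e.1 e.2 <= d f.1 f.2)%E) ->
    greedy_run d (e |: M)%SET.

Definition greedy_matching (R : realType) (n : nat)
    (d : 'I_n -> 'I_n -> \bar R) (M : {set 'I_n * 'I_n}) : Prop :=
  greedy_run d M /\ perfect_matching M.

(* When the graph has a component of odd order every perfect matching costs
   +oo; such an outcome is optimal, so +oo / +oo is read as 1 (whereas
   +oo / +oo = 0 in \bar R). *)
Definition approx_ratio (R : realType) (x y : \bar R) : \bar R :=
  if (x == +oo%E) && (y == +oo%E) then 1%E else (x / y)%E.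

Definition mutually_independent (d : measure_display) (T : measurableType d)
    (R : realType) (P : probability T R) (I : finType) (D : {set I})
    (F : I -> set (set T)) : Prop :=
  forall (J : {set I}) (A : I -> set T),
    J \subset D -> (forall i, i \in J -> F i (A i)) ->
    P (\bigcap_(i in [set` J]) A i) = (\prod_(i in J) P (A i))%E.

(* The sigma-algebra generated by X. *)
Definition sigma_rv (d d' : measure_display) (T : measurableType d)
    (S : measurableType d') (X : T -> S) : set (set T) :=
  preimage_set_system setT X measurable.

(* X e tells whether e is an edge, W e is the weight of e. Weights are drawn
   for all pairs, independently of the graph; only those of edges matter. *)
Record er_exp_model (n : nat) (d : measure_display) (T : measurableType d)
    (R : realType) (P : probability T R) (p : R)
    (X : 'I_n * 'I_n -> {RV P >-> bool})
    (W : 'I_n * 'I_n -> {RV P >-> R}) : Prop := ErExpModel {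
  er_edge_law : forall e, e \in pairs n ->
    forall A : set bool, distribution P (X e) A = bernoulli_prob p A;
  er_weight_law : forall e, e \in pairs n ->
    forall B : set R, measurable B ->
      distribution P (W e) B = exponential_prob 1 B;
  er_indep : mutually_independent P
    [set i : ('I_n * 'I_n) + ('I_n * 'I_n) |
       match i with inl e => e \in pairs n | inr e => e \in pairs n end]%SET
    (fun i => match i with inl e => sigma_rv (X e) | inr e => sigma_rv (W e) end) }.

Definition random_sp_metric (n : nat) (d : measure_display)
    (T : measurableType d) (R : realType) (P : probability T R)
    (X : 'I_n * 'I_n -> {RV P >-> bool}) (W : 'I_n * 'I_n -> {RV P >-> R})
    (t : T) : 'I_n -> 'I_n -> \bar R :=
  sp_dist [set e in pairs n | X e t]%SET (fun e => W e t).

(* Main.v *)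
Require Import Defs.
From mathcomp Require Import all_boot all_order all_algebra.
From mathcomp Require Import all_classical all_reals all_analysis.
From mathcomp Require Import measurable_realfun zify ring lra.

(* All lengths are of order 1/(np), up to logarithms.

   Whatever the outcome, greedy is within a factor O(n) of the optimum: the optimal
   matching can be repaired after each greedy step so that it still matches all
   remaining vertices, at a cost at most the optimum plus what greedy has spent;
   the next greedy edge is at most the average edge of the repaired matching.
   Events of probability O(1/n) can therefore be ignored.

   Outside such events fewer than n/8 edges are lighter than a small multiple of
   1/(np), so every perfect matching costs at least a constant times 1/p.

   For the upper bound on greedy, the greedy edges longer than r yield as many
   vertices at pairwise distance more than r. Take r of order z^2/(np) for an
   integer z up to a multiple of sqrt (ln n), and keep the edges of weight of that
   order, which have density about z^2/n. A union bound over pairs of vertex sets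
   shows that a set of n/z^4 vertices grows to n/z^3, n/z^2 and n/z vertices in
   three steps, and that two sets of size n/z are joined by an edge; so there are
   at most O(n/z^4) vertices at pairwise distance more than r. At the last scale
   sets double in size at each step until they have n/10 elements, which bounds the
   diameter by O((ln n)^2/(np)). Summing the layers,
   (1/(np)) (sum_z z * n/z^4 + (ln n)^2 * n/(ln n)^2) = O(1/p). *)

Set Implicit Arguments.
Unset Strict Implicit.

Import Order.TTheory GRing.Theory Num.Theory.
Import numFieldNormedType.Exports.

Local Open Scope classical_set_scope.
Local Open Scope ring_scope.

(** * Shortest-path distances *)

Lemma upairC (n : nat) (u v : 'I_n) : upair u v = upair v u.
Proof.
rewrite /upair; case: ltngtP => // /val_inj ->//.
Qed.

Lemma upair_pairs (n : nat) (u v : 'I_n) : (upair u v \in pairs n) = (u != v).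
Proof.
rewrite inE /upair; case: ifPn => /= h.
  by rewrite h; apply/esym; rewrite neq_ltn h.
by rewrite -(inj_eq val_inj) /= neq_ltn (negbTE h).
Qed.

Lemma upair_incident (n : nat) (u v : 'I_n) :
  ((upair u v).1 == u) || ((upair u v).2 == u).
Proof. by rewrite /upair; case: ifP => _ /=; rewrite eqxx ?orbT. Qed.

Lemma adjC (n : nat) (E : {set 'I_n * 'I_n}) (u v : 'I_n) : adj E u v = adj E v u.
Proof. by rewrite /adj upairC. Qed.

Section ShortestPaths.
Context (R : realType) (n : nat) (E : {set 'I_n * 'I_n}) (w : 'I_n * 'I_n -> R).
Implicit Types (u v x : 'I_n) (s : seq 'I_n).

Lemma path_weight_cons u x s :
  path_weight w u (x :: s) = w (upair u x) + path_weight w x s.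
Proof. by rewrite /path_weight /= big_cons. Qed.

Lemma path_weight_nil u : path_weight w u [::] = 0.
Proof. by rewrite /path_weight /= big_nil. Qed.

Lemma path_weight_cat u s1 s2 :
  path_weight w u (s1 ++ s2) = path_weight w u s1 + path_weight w (last u s1) s2.
Proof.
elim: s1 u => [|x s IH] u /=; first by rewrite path_weight_nil add0r.
by rewrite !path_weight_cons IH addrA.
Qed.

Lemma path_weight_rev u s :
  path_weight w (last u s) (rev (belast u s)) = path_weight w u s.
Proof.
elim: s u => [|x s IH] u //=.
rewrite rev_cons -cats1 path_weight_cat IH path_weight_cons.
rewrite path_weight_cons path_weight_nil addr0 addrC; congr (_ + _).
rewrite upairC; congr (w (upair _ _)).
by case: s {IH} => //= y s; rewrite rev_cons last_rcons.
Qed.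

Context (w_ge0 : forall e, e \in E -> 0 <= w e).

Lemma path_weight_ge0 u s : path (adj E) u s -> 0 <= path_weight w u s.
Proof.
elim: s u => [|x s IH] u /=; first by rewrite path_weight_nil.
by move=> /andP[ux /IH]; rewrite path_weight_cons => ?; rewrite addr_ge0 // w_ge0.
Qed.

(** Loop erasure: when the new head already occurs on the simple path, the cycle through it is cut
    out, and nonnegative weights make the shortcut no heavier. *)
Lemma path_weight_uniq u s : path (adj E) u s -> exists s',
  [/\ path (adj E) u s', last u s' = last u s, uniq (u :: s') &
      path_weight w u s' <= path_weight w u s].
Proof.
elim: s u => [|x s IH] u /=; first by exists [::].
move=> /andP[ux /IH[s' [ps' ls' us' ws']]].
have [us|us] := boolP (u \in x :: s'); last first.
  exists (x :: s'); rewrite /= ux; split=> //; last first.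
    by rewrite !path_weight_cons lerD2l.
  by apply/andP; split.
have wux := w_ge0 ux.
move: us; rewrite inE => /orP[/eqP ux'|us'u].
  subst x; exists s'; split=> //.
  by rewrite path_weight_cons (le_trans ws') // lerDr.
case/splitPr: us'u ps' ls' us' ws' => s1 s2.
rewrite cat_path last_cat => /=/and3P[p1 p2 p3] ls us ws.
exists s2; split=> //.
  by move: us; rewrite cat_uniq /= => /and4P[_ _ _ /andP[]] // -> ->.
rewrite path_weight_cons; move: ws; rewrite path_weight_cat path_weight_cons.
have := path_weight_ge0 p1; have := w_ge0 p2; lra.
Qed.

(** Any walk bounds the distance, not only the simple paths of the definition, so walks can be
    reversed and concatenated freely. *)
Lemma sp_dist_le u s : path (adj E) u s ->
  (sp_dist E w u (last u s) <= (path_weight w u s)%:E)%E.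
Proof.
move=> /path_weight_uniq[s' [ps' ls' us' ws']].
apply: (@le_trans _ _ (path_weight w u s')%:E); last by rewrite lee_fin.
by apply: ereal_inf_lbound; exists s' => //=; rewrite ps' ls' eqxx.
Qed.

Lemma sp_dist_ge u v (b : \bar R) :
  (forall s, path (adj E) u s -> last u s = v -> (b <= (path_weight w u s)%:E)%E) ->
  (b <= sp_dist E w u v)%E.
Proof.
move=> h; apply: le_ereal_inf_tmp => _ [s /= /and3P[ps /eqP ls _] <-].
exact: h.
Qed.

Lemma sp_dist_ge0 u v : (0 <= sp_dist E w u v)%E.
Proof. by apply: sp_dist_ge => s ps _; rewrite lee_fin path_weight_ge0. Qed.

Lemma sp_dist_sym u v : sp_dist E w u v = sp_dist E w v u.
Proof.
suff h a b : (sp_dist E w a b <= sp_dist E w b a)%E by apply/le_anti; rewrite !h.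
apply: sp_dist_ge => s ps ls.
have ps' : path (adj E) (last b s) (rev (belast b s)).
  by rewrite rev_path; apply: sub_path ps => x y; rewrite /= adjC.
have := sp_dist_le ps'; rewrite path_weight_rev ls.
suff -> : last a (rev (belast b s)) = b by [].
rewrite -ls; case: s {ps ls ps'} => //= y s; by rewrite rev_cons last_rcons.
Qed.

Lemma sp_dist_refl u : sp_dist E w u u = 0%E.
Proof.
apply/le_anti; rewrite sp_dist_ge0 andbT.
have /= := @sp_dist_le u [::] isT; by rewrite path_weight_nil.
Qed.

Lemma sp_dist_tri v u x : (sp_dist E w u x <= sp_dist E w u v + sp_dist E w v x)%E.
Proof.
(* Moving a distance across an inequality in [\bar R] requires it to be finite; the infinite case is
   trivial. *)
have [->|vx] := eqVneq (sp_dist E w v x) +oo%E.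
  by rewrite addey ?leey // gt_eqF // (lt_le_trans _ (sp_dist_ge0 _ _)) ?ltNyr.
rewrite -leeBlDr; last by rewrite ge0_fin_numE ?sp_dist_ge0 // ltey.
apply: sp_dist_ge => s ps ls.
rewrite leeBlDr; last by rewrite ge0_fin_numE ?sp_dist_ge0 // ltey.
rewrite addeC -leeBlDr //; apply: sp_dist_ge => s' ps' ls'.
rewrite leeBlDr // -EFinD addrC.
have := @sp_dist_le u (s ++ s'); rewrite cat_path ps last_cat ls ps' ls' => /(_ isT).
by rewrite path_weight_cat ls.
Qed.

(** The first edge of a path is no heavier than the path. *)
Lemma sp_dist_lt_edge u v (r : R) : u != v -> (sp_dist E w u v < r%:E)%E ->
  exists2 e, (e \in E) && (w e < r) & (e.1 == u) || (e.2 == u).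
Proof.
move=> uv /ereal_inf_lt[_ [s /= /and3P[ps /eqP ls _] <-]].
rewrite lte_fin; case: s ps ls => [|x s] /=; first by move=> _ /eqP; rewrite (negbTE uv).
move=> /andP[ux ps] _ ; rewrite path_weight_cons => h.
exists (upair u x); last exact: upair_incident.
apply/andP; split=> //; have := path_weight_ge0 ps; lra.
Qed.

End ShortestPaths.

(** * The greedy matching against the optimum *)

Lemma unmatchedU1 (n : nat) (M : {set 'I_n * 'I_n}) e (x : 'I_n) :
  unmatched (e |: M)%SET x = [&& e.1 != x, e.2 != x & unmatched M x].
Proof.
apply/forall_inP/and3P => [h|[h1 h2 /forall_inP h] f].
  have /andP[h1 h2] := h e (setU11 _ _).
  by split=> //; apply/forall_inP => f fM; apply: h; rewrite setU1r.
by rewrite in_setU1 => /orP[/eqP ->|/h //]; rewrite h1.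
Qed.

Lemma unmatched0 (n : nat) (x : 'I_n) : unmatched finset.set0 x.
Proof. by apply/forall_inP => e; rewrite inE. Qed.

Lemma unmatchedN (n : nat) (M : {set 'I_n * 'I_n}) e : unmatched M e.1 -> e \notin M.
Proof. by move=> /forall_inP h; apply/negP => /h; rewrite eqxx. Qed.

Lemma free_pairsE (n : nat) (M : {set 'I_n * 'I_n}) (x y : 'I_n) :
  (upair x y \in free_pairs M) = [&& x != y, unmatched M x & unmatched M y].
Proof.
rewrite inE upair_pairs /upair; case: ifP => _ //=.
by rewrite [unmatched M y && _]andbC.
Qed.

Lemma perfect_matching_cover (n : nat) (M : {set 'I_n * 'I_n}) (x : 'I_n) :
  perfect_matching M -> exists e, [set e in M | (e.1 == x) || (e.2 == x)]%SET = [set e]%SET.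
Proof. by move=> /andP[_ /forallP /(_ x) /cards1P]. Qed.

Lemma sum_pair_incident (V : nmodType) (n : nat) (f : V) (e : 'I_n * 'I_n) :
  e.1 != e.2 -> \sum_(x | (e.1 == x) || (e.2 == x)) f = f + f.
Proof.
move=> ne; rewrite (bigD1 e.1) ?eqxx //= (big_pred1 e.2) // => x.
have [<-|h] := eqVneq e.1 x; first by rewrite /= (negbTE ne).
by rewrite /= andbT eq_sym.
Qed.

Lemma perfect_matching_sum (V : nmodType) (n : nat) (M : {set 'I_n * 'I_n})
    (f : 'I_n * 'I_n -> V) : perfect_matching M ->
  \sum_x \sum_(e in M | (e.1 == x) || (e.2 == x)) f e = \sum_(e in M) (f e + f e).
Proof.
move=> pM; rewrite (exchange_big_dep (mem M)) /=; last by move=> x e _ /andP[].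
apply: eq_bigr => e eM; rewrite -(@sum_pair_incident _ _ (f e) e).
  by apply: eq_bigl => x; rewrite eM.
have /andP[/fintype.subsetP /(_ _ eM)] := pM; rewrite inE neq_ltn => -> //.
Qed.

Lemma perfect_matching_card (n : nat) (M : {set 'I_n * 'I_n}) :
  perfect_matching M -> #|M|.*2 = n.
Proof.
move=> pM; have := perfect_matching_sum (fun _ => 1%N) pM.
rewrite !sum_nat_const muln2 => <-.
rewrite (eq_bigr (fun _ => 1%N)) ?sum1_card ?card_ord // => x _.
have [e he] := perfect_matching_cover x pM.
rewrite (eq_bigl (mem [set e]%SET)) ?big_set1 // => f.
by rewrite -he !inE.
Qed.

Section GreedyApproximation.
Context (R : realType) (n : nat) (d : 'I_n -> 'I_n -> \bar R).
Context (d_ge0 : forall u v, (0 <= d u v)%E) (d_refl : forall u, d u u = 0%E)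
  (d_sym : forall u v, d u v = d v u)
  (d_tri : forall v u x, (d u x <= d u v + d v x)%E).

Lemma matching_cost_ge0 M : (0 <= matching_cost d M)%E.
Proof. by apply: sume_ge0. Qed.

Lemma min_matching_cost_le M : perfect_matching M ->
  (min_matching_cost d <= matching_cost d M)%E.
Proof. by move=> pM; apply: ereal_inf_lbound; exists M. Qed.

Lemma min_matching_cost_ge0 : (0 <= min_matching_cost d)%E.
Proof. by apply: le_ereal_inf_tmp => _ [M _ <-]; exact: matching_cost_ge0. Qed.

(** [s] sends a vertex to its partner, a form in which the matching is easy to repair. The cost
    doubles because every pair is met from both ends. *)
Lemma perfect_matching_involution M : perfect_matching M ->
  exists s : 'I_n -> 'I_n, [/\ involutive s, forall x, s x != x &
    (\sum_x d x (s x) = matching_cost d M + matching_cost d M)%E].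
Proof.
move=> pM; have [Msub _] := andP pM.
have inc x : exists e, e \in M /\ (forall f, (f \in M) && ((f.1 == x) || (f.2 == x)) = (f == e)).
  have [e he] := perfect_matching_cover x pM; exists e.
  split; last by move=> f; have /setP/(_ f) := he; rewrite !inE.
  by have := finset.set11 e; rewrite -he inE => /andP[].
pose E x := sval (cid (inc x)).
have EP x : E x \in M /\ (forall f, (f \in M) && ((f.1 == x) || (f.2 == x)) = (f == E x)).
  exact: (svalP (cid (inc x))).
have EM x : E x \in M by case: (EP x).
have Ex x : ((E x).1 == x) || ((E x).2 == x).
  by have [_ /(_ (E x))] := EP x; rewrite eqxx EM.
have Eu x f : f \in M -> (f.1 == x) || (f.2 == x) -> f = E x.
  by move=> fM fx; apply/eqP; have [_ <-] := EP x; rewrite fM.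
have Ene x : (E x).1 != (E x).2.
  by have := fintype.subsetP Msub _ (EM x); rewrite inE neq_ltn => ->.
pose s x := if (E x).1 == x then (E x).2 else (E x).1.
have sE x : E (s x) = E x.
  by apply/esym/Eu => //; rewrite /s; case: ifP => _; rewrite eqxx ?orbT.
exists s; split.
- move=> x; have -> : s (s x) = if (E x).1 == s x then (E x).2 else (E x).1.
    by rewrite {1}/s sE.
  have [h|h] := boolP ((E x).1 == x).
    by rewrite /s h (negbTE (Ene x)); exact/eqP.
  by rewrite /s (negbTE h) eqxx; have := Ex x; rewrite (negbTE h) => /eqP.
- move=> x; rewrite /s; case: ifPn => [/eqP h|h //]; by rewrite -{2}h eq_sym.
rewrite /matching_cost -big_split /= -(perfect_matching_sum _ pM).
apply: eq_bigr => x _; have [_ h] := EP x.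
rewrite (eq_bigl _ _ h) big_pred1_eq /s; case: ifPn => [/eqP ->//|h'].
by have := Ex x; rewrite (negbTE h') /= => /eqP ->; rewrite d_sym.
Qed.

(* After [u] and [v] have been matched with each other, their former partners
   are matched; by the triangle inequality this costs at most [d u v] more. *)
Definition rematch (s : 'I_n -> 'I_n) (u v x : 'I_n) :=
  if x == u then u else if x == v then v else
  if x == s u then s v else if x == s v then s u else s x.

Section Rematch.
Context (s : 'I_n -> 'I_n) (u v : 'I_n) (sK : involutive s) (uv : u != v)
  (su : s u != u) (sv : s v != v).

Let s_eq x y : (s x == y) = (x == s y).
Proof. by rewrite -(inj_eq (can_inj sK)) sK. Qed.

Let vu : (v == u) = false. Proof. by rewrite eq_sym (negbTE uv). Qed.

Lemma rematchK : involutive (rematch s u v).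
Proof.
move=> x; rewrite {2}/rematch.
have [->|xu] := eqVneq x u; first by rewrite /rematch eqxx.
have [->|xv] := eqVneq x v; first by rewrite /rematch vu eqxx.
have [xsu|xsu] := eqVneq x (s u).
  have h1 : (s v == u) = false by rewrite s_eq -xsu eq_sym; apply/negbTE.
  have h2 : (s v == s u) = false by rewrite (inj_eq (can_inj sK)) vu.
  by rewrite /rematch h1 (negbTE sv) h2 eqxx.
have [xsv|xsv] := eqVneq x (s v).
  have h1 : (s u == v) = false by rewrite s_eq -xsv eq_sym; apply/negbTE.
  by rewrite /rematch (negbTE su) h1 eqxx.
have h z : (s x == z) = (x == s z) := s_eq x z.
by rewrite /rematch !h (negbTE xsu) (negbTE xsv) !sK (negbTE xu) (negbTE xv).
Qed.

(** A fixed point stands for a vertex that greedy has already matched; the repair retires exactly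
    [u] and [v]. *)
Lemma rematch_fix x : (rematch s u v x != x) = [&& u != x, v != x & s x != x].
Proof.
rewrite /rematch ![_ == x]eq_sym.
have [->|xu] := eqVneq x u; first by rewrite eqxx.
have [->|xv] := eqVneq x v; first by rewrite eqxx.
have [->|xsu] := eqVneq x (s u).
  by rewrite (inj_eq (can_inj sK)) uv sK su.
have [->|xsv] := eqVneq x (s v).
  by rewrite (inj_eq (can_inj sK)) vu sK sv.
by [].
Qed.

Lemma rematch_cost :
  (\sum_x d x (rematch s u v x) <= \sum_x d x (s x) + (d u v + d u v))%E.
Proof.
(* If [u] and [v] were already partners, the repair only drops a pair. *)
have [suv|suv] := eqVneq (s u) v.
  apply: (@le_trans _ _ (\sum_x d x (s x))%E); last by rewrite leeDl // adde_ge0.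
  apply: lee_sum => x _; rewrite /rematch.
  have [->|xu] := eqVneq x u; first by rewrite d_refl.
  have [->|xv] := eqVneq x v; first by rewrite d_refl.
  by rewrite suv (negbTE xv) -suv sK (negbTE xu).
have vsu : s v != u by rewrite s_eq eq_sym.
have ne : s v != s u by rewrite (inj_eq (can_inj sK)) eq_sym.
(* Only [u], [v] and their former partners change; the new pair is charged to the route [s u], [u],
   [v], [s v]. *)
have D f : (\sum_x f x = f u + (f v + (f (s u) + (f (s v) +
    \sum_(x | [&& x != u, x != v, x != s u & x != s v]) f x))) :> \bar R)%E.
  rewrite (bigD1 u) //= (bigD1 v) /= ?vu //.
  rewrite (bigD1 (s u)) /= ?su ?suv // (bigD1 (s v)) /= ?vsu ?sv ?ne //.
  do 4 congr (_ + _)%E; apply: eq_bigl => x.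
  by rewrite -!andbA.
rewrite !D {1 2 3 4}/rematch !eqxx !d_refl !sK (negbTE su) (negbTE sv).
rewrite (negbTE suv) (negbTE vsu) (negbTE ne) vu !add0e.
rewrite (eq_bigr (fun x => d x (s x))); last first.
  move=> x /and4P[/negbTE h1 /negbTE h2 /negbTE h3 /negbTE h4].
  by rewrite /rematch h1 h2 h3 h4.
set S := (\sum_(x | _) _)%E.
have h1 : (d (s u) (s v) <= d u (s u) + (d u v + d v (s v)))%E.
  apply: (le_trans (d_tri u _ _)); rewrite [d (s u) u]d_sym leeD2l //.
have h2 : (d (s v) (s u) <= d (s u) u + (d u v + d (s v) v))%E.
  by rewrite d_sym [d (s u) u]d_sym [d (s v) v]d_sym.
rewrite d_refl add0e; apply: (le_trans (leeD h1 (leeD h2 (lexx S)))).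
by rewrite !addeA [leLHS](ACl (1*3*4*6*7*2*5)%AC).
Qed.
End Rematch.

(* [s] pairs up the vertices that greedy has not matched yet, at a cost at most
   that of the optimum plus what greedy has spent; hence the next greedy edge is
   at most the average of these distances. *)
Lemma greedy_run_invariant (o : R) (s0 : 'I_n -> 'I_n) : involutive s0 ->
  (forall x, s0 x != x) -> (\sum_x d x (s0 x) <= (o + o)%:E)%E -> 0 <= o ->
  forall M, greedy_run d M -> exists (g : R) (s : 'I_n -> 'I_n),
    [/\ matching_cost d M = g%:E, involutive s,
        forall x, unmatched M x = (s x != x),
        (\sum_x d x (s x) <= (o + o + (g + g))%:E)%E &
        [/\ (#|[set x | unmatched M x]%SET| + #|M|.*2 = n)%N, 0 <= g &
        (n.+2%:R - (#|M|.*2)%:R) * (g + o) <= n.+2%:R * o]].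
Proof.
move=> s0K s0x s0c o0 M; elim=> {M} [|M e _ [g [s [cM sK sU sc [cU g0 gb]]]] eF emin].
  exists 0, s0; rewrite /matching_cost big_set0 !addr0; split=> //.
    by move=> x; rewrite unmatched0 s0x.
  rewrite cards0 subr0 addn0 add0r; split=> //.
  by rewrite -[RHS]card_ord -cardsT; apply: eq_card => x; rewrite !inE unmatched0.
have := eF; rewrite inE => /and3P[ep ue1 ue2].
have e12 : e.1 != e.2 by move: ep; rewrite inE neq_ltn => ->.
have eM : e \notin M by apply: unmatchedN.
have umin x y : s x != x -> s y != y -> x != y -> (d e.1 e.2 <= d x y)%E.
  rewrite -!sU => ux uy xy; have := emin (upair x y).
  rewrite free_pairsE xy ux uy => /(_ isT).
  by rewrite /upair; case: ifP => _ //=; rewrite [d y x]d_sym.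
(* Every free vertex has a free partner under [s], so its term is at least the greedy edge. *)
have sumin : (\sum_(x in [set x | unmatched M x]%SET) d e.1 e.2 <= \sum_x d x (s x))%E.
  rewrite big_mkcond /=; apply: lee_sum => x _; rewrite inE sU.
  by case: ifPn => // sx; apply: umin; rewrite // ?sK eq_sym.
have afin : d e.1 e.2 \is a fin_num.
  rewrite ge0_fin_numE //; apply: (@le_lt_trans _ _ (o + o + (g + g))%:E); last exact: ltry.
  apply: le_trans sc; apply: le_trans sumin.
  by rewrite (bigD1 e.1) ?inE //= leeDl // sume_ge0.
set a := fine (d e.1 e.2); have aE : d e.1 e.2 = a%:E by rewrite fineK.
have a0 : 0 <= a by rewrite -lee_fin -aE.
exists (a + g), (rematch s e.1 e.2); split.
- by rewrite /matching_cost big_setU1 //= -/(matching_cost d M) cM aE -EFinD.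
- by apply: rematchK; rewrite // -sU.
- by move=> x; rewrite unmatchedU1 rematch_fix // -?sU.
- apply: le_trans (rematch_cost sK e12 _ _) _; rewrite -?sU // aE -EFinD.
  apply: le_trans (leeD2r _ sc) _; rewrite -EFinD lee_fin; lra.
have cU' : (#|[set x | unmatched (e |: M)%SET x]%SET| + 2 = #|[set x | unmatched M x]%SET|)%N.
  rewrite (cardsD1 e.1 [set x | unmatched M x]%SET) inE ue1.
  rewrite (cardsD1 e.2 ([set x | unmatched M x]%SET :\ e.1)%SET) !inE ue2 eq_sym e12 /=.
  rewrite addnC; congr (2 + _)%N; apply: eq_card => x; rewrite !inE unmatchedU1.
  by rewrite [x == e.1]eq_sym [x == e.2]eq_sym andbCA.
rewrite cardsU1 eM add1n doubleS.
rewrite -[(#|M|.*2).+2]addn2.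
split; [by rewrite [(_ + 2)%N]addnC addnA cU'|exact: addr_ge0|].
(* With U free vertices, [h] gives U a <= 2 (g + o), so the step multiplies g + o by at most (U + 2)
   / U. As U then drops by 2, (U + 2) (g + o) never increases; it starts at (n + 2) o. *)
have h : #|[set x | unmatched M x]%SET|%:R * a <= o + o + (g + g).
  rewrite -lee_fin; apply: le_trans sc; apply: le_trans sumin.
  by rewrite aE sumEFin lee_fin sumr_const mulr_natl.
have cR : n%:R = #|[set x | unmatched M x]%SET|%:R + (#|M|.*2)%:R :> R.
  by rewrite -natrD cU.
move: gb h; rewrite -[n.+2]addn2 !natrD cR.
set U := #|_|%:R; set K := _%:R => gb h.
have -> : (U + K + 2 - (K + 2)) * (a + g + o) = U * a + U * (g + o) by ring.
have -> : (U + K + 2) * o = (U + K + 2) * o by [].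
have : (U + K + 2 - K) * (g + o) = U * (g + o) + 2 * (g + o) by ring.
move=> E; rewrite E in gb; lra.
Qed.

(** For a perfect matching the invariant reads 2 (g + o) <= (n + 2) o, hence g <= n o / 2. *)
Lemma greedy_le_opt M : greedy_matching d M ->
  (matching_cost d M <= n.+2%:R%:E * min_matching_cost d)%E.
Proof.
move=> [gM pM].
rewrite muleC -lee_pdivrMr // /min_matching_cost.
apply: le_ereal_inf_tmp => _ [N pN <-].
have [->|Nfin] := eqVneq (matching_cost d N) +oo%E; first exact: leey.
have [s [sK sx sc]] := perfect_matching_involution pN.
have Nf : matching_cost d N \is a fin_num.
  by rewrite ge0_fin_numE ?matching_cost_ge0 // ltey.
set o := fine (matching_cost d N); have oE : matching_cost d N = o%:E by rewrite fineK.
have o0 : 0 <= o by rewrite -lee_fin -oE matching_cost_ge0.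
have [|g [s' [-> _ _ _ [_ _]]]] := greedy_run_invariant sK sx _ o0 gM.
  by rewrite sc oE -EFinD.
rewrite perfect_matching_card // lee_pdivrMr // oE -EFinM lee_fin.
have -> : n.+2%:R = n%:R + 2 :> R by rewrite -addn2 natrD.
have := mulr_ge0 (ler0n R n) o0; set N' := n%:R => h1 h2; lra.
Qed.

(* When greedy picks [f], every vertex that is still free afterwards was a
   possible partner of [f.1]. *)
Lemma greedy_run_separated M : greedy_run d M ->
  (forall f x, f \in M -> unmatched M x -> (d f.1 f.2 <= d f.1 x)%E) /\
  (forall f f', f \in M -> f' \in M -> f != f' ->
        (mine (d f.1 f.2) (d f'.1 f'.2) <= d f.1 f'.1)%E /\ f.1 != f'.1).
Proof.
elim=> {M} [|M e _ [Mx Mf] eF emin].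
  by split=> [f x|f f']; rewrite finset.in_set0.
have := eF; rewrite inE => /and3P[ep ue1 ue2].
have umin x y : x != y -> unmatched M x -> unmatched M y -> (d e.1 e.2 <= d x y)%E.
  move=> xy ux uy; have := emin (upair x y).
  rewrite free_pairsE xy ux uy => /(_ isT).
  by rewrite /upair; case: ifP => _ //=; rewrite [d y x]d_sym.
split.
- move=> f x; rewrite in_setU1 unmatchedU1 => /orP[/eqP ->|fM] /and3P[h1 h2 ux].
    exact: umin.
  exact: Mx.
move=> f f'; rewrite !in_setU1.
have h f0 : f0 \in M -> (d f0.1 f0.2 <= d f0.1 e.1)%E /\ f0.1 != e.1.
  move=> f0M; split; first exact: Mx.
  by have /forall_inP /(_ _ f0M) /andP[] := ue1.
move=> /orP[/eqP ->|fM] /orP[/eqP ->|f'M] ff'.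
- by rewrite eqxx in ff'.
- have [h1 h2] := h _ f'M; rewrite [_ == f'.1]eq_sym h2; split=> //.
  by rewrite ge_min [d e.1 f'.1]d_sym h1 orbT.
- have [h1 h2] := h _ fM; split=> //.
  by rewrite ge_min h1.
exact: Mf.
Qed.

(** [S] collects the first endpoints of the long edges: two of them are at least as far apart as the
    shorter of their greedy edges. *)
Lemma greedy_heavy_separated M (r : \bar R) : greedy_run d M ->
  exists2 S : {set 'I_n}, #|S| = #|[set e in M | (r < d e.1 e.2)%E]%SET| &
    forall x y, x \in S -> y \in S -> x != y -> (r < d x y)%E.
Proof.
move=> /greedy_run_separated[_ h].
exists [set e.1 | e in [set e in M | (r < d e.1 e.2)%E]]%SET.
  apply: card_in_imset => e f; rewrite !inE => /andP[eM _] /andP[fM _] ef.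
  apply/eqP/negPn/negP => /(h _ _ eM fM)[_]; by rewrite ef eqxx.
move=> _ _ /imsetP[e + ->] /imsetP[f + ->].
rewrite !inE => /andP[eM re] /andP[fM rf] ef.
have [|h1 _] := h e f eM fM; first by apply: contraNneq ef => ->.
by apply: lt_le_trans h1; rewrite lt_min re.
Qed.

End GreedyApproximation.

(** * Neighbourhood growth *)

Section Expansion.
Context (n : nat) (F : {set 'I_n * 'I_n}).
Implicit Types (S : {set 'I_n}) (u v : 'I_n).

(** The property of the random graph that drives the growth. It passes to larger sets, so it need
    only be checked at sizes exactly [k] and [l]. *)
Definition linked (k l : nat) : Prop :=
  forall S S', [disjoint S & S']%B -> (k <= #|S|)%N -> (l <= #|S'|)%N ->
    exists u v, [/\ u \in S, v \in S' & adj F u v].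

Definition nbhd S : {set 'I_n} :=
  (S :|: [set v | [exists u in S, adj F u v]])%SET.

Definition walk_le (i : nat) u v :=
  exists s, [/\ path (adj F) u s, last u s = v & (size s <= i)%N].

Lemma walk_leC i u v : walk_le i u v -> walk_le i v u.
Proof.
move=> [s [ps ls ss]]; exists (rev (belast u s)); split.
- by rewrite -ls rev_path; apply: sub_path ps => x y; rewrite /= adjC.
- by rewrite -ls; case: s {ps ls ss} => //= y s; rewrite rev_cons last_rcons.
- by rewrite size_rev size_belast.
Qed.

Lemma walk_le_trans i j u v x : walk_le i u v -> walk_le j v x -> walk_le (i + j) u x.
Proof.
move=> [s [ps ls ss]] [s' [ps' ls' ss']]; exists (s ++ s').
by rewrite cat_path last_cat ps ls size_cat leq_add.
Qed.

Lemma walk_le_widen i j u v : (i <= j)%N -> walk_le i u v -> walk_le j u v.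
Proof. by move=> ij [s [ps ls ss]]; exists s; split=> //; exact: leq_trans ij. Qed.

Lemma walk_le1 u v : adj F u v -> walk_le 1 u v.
Proof. by move=> uv; exists [:: v]; rewrite /= uv. Qed.

Lemma sub_nbhd S : S \subset nbhd S.
Proof. exact: finset.subsetUl. Qed.

Lemma iter_nbhd_walk i S v : v \in iter i nbhd S -> exists2 u, u \in S & walk_le i u v.
Proof.
elim: i v => [|i IH] v /=; first by move=> vS; exists v => //; exists [::].
rewrite finset.in_setU inE => /orP[/IH[u uS uv]|/exists_inP[x /IH[u uS ux] xv]].
  by exists u => //; apply: walk_le_widen uv.
by exists u => //; rewrite -addn1; apply: walk_le_trans (walk_le1 xv).
Qed.

(** The complement of [nbhd S] is disjoint from [S] and receives no edge from it, so it has fewer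
    than [l] elements. *)
Lemma nbhd_linked k l S : linked k l -> (k <= #|S|)%N -> (n < #|nbhd S| + l)%N.
Proof.
move=> kl kS; rewrite ltnNge; apply/negP => h.
have [|//||u [v [uS vS uv]]] := kl S (~: nbhd S)%SET.
- by rewrite finset.disjoints_subset finset.setCK sub_nbhd.
- by rewrite cardsCs finset.setCK card_ord; lia.
by move: vS; rewrite !inE negb_or => /andP[_ /exists_inP[]]; exists u.
Qed.

(** The two [i]-step neighbourhoods meet or are joined by an edge, which gives a walk of at most i +
    1 + i edges. *)
Lemma iter_nbhd_linked k i S S' : linked k k ->
    (k <= #|iter i nbhd S|)%N -> (k <= #|iter i nbhd S'|)%N ->
  exists u v, [/\ u \in S, v \in S' & walk_le i.*2.+1 u v].
Proof.
move=> kk kS kS'.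
suff [x [y [xS yS xy]]] : exists x y, [/\ x \in iter i nbhd S, y \in iter i nbhd S' &
    walk_le 1 x y].
  have [u uS ux] := iter_nbhd_walk xS; have [v vS vy] := iter_nbhd_walk yS.
  exists u, v; split=> //; rewrite -addnn -addSn -addn1.
  exact: walk_le_trans (walk_le_trans ux xy) (walk_leC vy).
have [dis|/pred0Pn[x /= /andP[xS xS']]] := boolP [disjoint iter i nbhd S & iter i nbhd S']%B.
  have [x [y [xS yS xy]]] := kk _ _ dis kS kS'.
  by exists x, y; split=> //; exact: walk_le1.
by exists x, x; split=> //; exists [::].
Qed.

(* Both halves of [S] grow in three steps from size [b3] to size [b0], after
   which they are joined by an edge. *)
Lemma linked_chain_separated b0 b1 b2 b3 S :
    (b0 <= n)%N -> (b1 <= n)%N -> (b2 <= n)%N ->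
    linked b0 b0 -> linked b1 (n - b0) -> linked b2 (n - b1) -> linked b3 (n - b2) ->
    (b3.*2 <= #|S|)%N ->
  exists u v, [/\ u \in S, v \in S, u != v & walk_le 7 u v].
Proof.
move=> hb0 hb1 hb2 L0 L1 L2 L3 bS.
have [S1 S1S cS1] : exists2 S1 : {set 'I_n}, S1 \subset S & #|S1| = b3.
  have /card_geqP[s [us ss sS]] : (b3 <= #|S|)%N by lia.
  exists [set x in s]; first by apply/fintype.subsetP => x; rewrite inE => /sS.
  by rewrite cardsE -ss; apply/card_uniqP.
have grow S' : (b3 <= #|S'|)%N -> (b0 <= #|iter 3 nbhd S'|)%N.
  have step k l (A : {set 'I_n}) : (l <= n)%N -> linked k (n - l) ->
      (k <= #|A|)%N -> (l <= #|nbhd A|)%N.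
    by move=> ln L /(nbhd_linked L); move: #|nbhd A| => c; lia.
  by move=> /(step _ _ _ hb2 L3) /(step _ _ _ hb1 L2) /(step _ _ _ hb0 L1).
(* Three steps from each half and one joining edge: 2 * 3 + 1 = 7. *)
have [||u [v [uS1]]] := @iter_nbhd_linked b0 3 S1 (S :\: S1)%SET L0.
- by apply: grow; rewrite cS1.
- by apply: grow; rewrite cardsD (finset.setIidPr S1S) cS1; lia.
rewrite inE => /andP[vS1 vS] uv; exists u, v; split=> //.
  by apply: (fintype.subsetP S1S).
by apply: contraNneq vS1 => <-.
Qed.

(** Fewer than n + 1 - 2k vertices lie outside the neighbourhood of a set of k < m vertices, so the
    set at least doubles; [D] doublings lead from one vertex to size [m]. *)
Lemma linked_doubling m D u v : linked m m ->
    (forall k, (0 < k < m)%N -> linked k (n.+1 - k.*2)) -> (m <= 2 ^ D)%N ->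
  walk_le D.*2.+1 u v.
Proof.
move=> mm L mD.
have grow x i : (minn (2 ^ i) m <= #|iter i nbhd [set x]%SET|)%N.
  elim: i => [|i IH] /=; first by rewrite cards1 geq_minl.
  set A := iter i nbhd _ in IH *.
  have sA := subset_leq_card (sub_nbhd A).
  have [mA|Am] := leqP m #|A|; first by rewrite geq_min (leq_trans mA sA) orbT.
  have A0 : (0 < #|A|)%N.
    apply: leq_trans IH; rewrite leq_min expn_gt0 /=.
    by apply: leq_ltn_trans Am.
  have kA : (0 < #|A| < m)%N by rewrite A0.
  have := nbhd_linked (L _ kA) (leqnn _).
  (* The bound by [n] settles the case where the natural subtraction is truncated to 0. *)
  have := max_card (mem (nbhd A)); rewrite card_ord expnS.
  move: IH Am; move: #|A| #|nbhd A| (2 ^ i)%N => a b c; lia.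
have [||x [y []]] := @iter_nbhd_linked m D [set u]%SET [set v]%SET mm.
- by apply: leq_trans (grow u D); rewrite leq_min mD leqnn.
- by apply: leq_trans (grow v D); rewrite leq_min mD leqnn.
by rewrite !finset.inE => /eqP -> /eqP ->.
Qed.

End Expansion.

(** * Light edges and distances *)

Section Light.
Context (R : realType) (n : nat) (E : {set 'I_n * 'I_n}) (w : 'I_n * 'I_n -> R).

Definition light (h : R) : {set 'I_n * 'I_n} := [set e in E | 0 <= w e <= h]%SET.

Context (w_ge0 : forall e, e \in E -> 0 <= w e).

Lemma walk_le_dist h i u v : 0 <= h -> walk_le (light h) i u v ->
  (sp_dist E w u v <= (i%:R * h)%:E)%E.
Proof.
move=> h0 [s [ps <- si]].
have ps' : path (adj E) u s.
  by apply: sub_path ps => x y; rewrite /adj inE => /andP[].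
apply: le_trans (sp_dist_le w_ge0 ps') _; rewrite lee_fin.
apply: (@le_trans _ _ ((size s)%:R * h)); last by rewrite ler_wpM2r // ler_nat.
elim: s u ps {ps' si} => [|x s IH] u /=; first by rewrite path_weight_nil mul0r.
rewrite path_weight_cons => /andP[+ /IH]; rewrite /adj inE => /andP[_ /andP[_ h1]] h2.
rewrite -add1n natrD mulrDl mul1r; lra.
Qed.

(** A short pair has a light edge at its first endpoint; these endpoints are distinct within a
    matching, and a light edge has only two ends. *)
Lemma light_edges_incident (M : {set 'I_n * 'I_n}) (r : R) : perfect_matching M ->
  (#|[set e in M | (sp_dist E w e.1 e.2 < r%:E)%E]%SET| <=
     #|[set e in E | (w e <= r)%R]%SET|.*2)%N.
Proof.
move=> pM; set H := [set e in M | _]%SET; set L := [set e in E | _]%SET.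
have Msub : M \subset pairs n by case/andP: pM.
have cH : #|[set e.1 | e in H]%SET| = #|H|.
  apply: card_in_imset => e f; rewrite !inE => /andP[eM _] /andP[fM _] ef.
  have [g hg] := perfect_matching_cover e.1 pM.
  have : e \in [set g]%SET by rewrite -hg inE eM eqxx.
  have : f \in [set g]%SET by rewrite -hg inE fM ef eqxx.
  by rewrite !finset.inE => /eqP -> /eqP ->.
rewrite -cH; apply: (@leq_trans #|[set e.1 | e in L]%SET :|: [set e.2 | e in L]%SET|).
  apply: subset_leq_card; apply/fintype.subsetP => _ /imsetP[e + ->].
  rewrite inE => /andP[/(fintype.subsetP Msub)]; rewrite inE => eM.
  move=> /(sp_dist_lt_edge w_ge0)[|f /andP[fE fr] fe]; first by rewrite neq_ltn eM.
  have fL : f \in L by rewrite inE fE ltW.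
  by rewrite finset.in_setU; case/orP: fe => /eqP <-; rewrite imset_f ?orbT.
rewrite -addnn; apply: leq_trans (leq_card_setU _ _) _.
by apply: leq_add; apply: leq_imset_card.
Qed.

End Light.

(** * Union bounds in the random model *)

Lemma exponential_prob_npos (R : realType) : exponential_prob (1 : R) `]-oo, 0] = 0%E.
Proof.
rewrite /exponential_prob -integral_itv_bndo_bndc.
  apply: integral0_eq => x /=; rewrite in_itv /= => x0.
  by rewrite lt0_exponential_pdf.
apply/measurable_EFinP; apply: measurable_funS (measurable_exponential_pdf _) => //.
Qed.

Lemma union_bound d (T : measurableType d) (R : realType) (P : probability T R)
    (I : finType) (D : {pred I}) (F : I -> set T) (x : R) (k : nat) :
    (forall i, i \in D -> measurable (F i)) ->
    (forall i, i \in D -> (P (F i) <= x%:E)%E) -> (#|D| <= k)%N -> 0 <= x ->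
  measurable (\bigcup_(i in [set` D]) F i) /\
  (P (\bigcup_(i in [set` D]) F i) <= (k%:R * x)%:E)%E.
Proof.
move=> mF PF cD x0; rewrite bigcup_pred.
have [mU PU] : measurable (\big[setU/set0]_(i in D) F i) /\
    (P (\big[setU/set0]_(i in D) F i) <= \sum_(i in D) P (F i))%E.
  elim/big_rec2: _ => [|i s A iD [mA PA]]; first by rewrite measure0.
  split; first by apply: measurableU => //; exact: mF.
  apply: (@le_trans _ _ (P (F i) + P A)%E); first by apply: measureU2 => //; exact: mF.
  exact: leeD2l.
split=> //; apply: le_trans PU _.
apply: le_trans (lee_sum _ PF) _.
by rewrite sumEFin lee_fin sumr_const -[x *+ _]mulr_natl ler_wpM2r // ler_nat.
Qed.

Section Model.
Context (n : nat) (d : measure_display) (T : measurableType d) (R : realType)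
  (P : probability T R) (p : R) (p01 : 0 <= p <= 1)
  (X : 'I_n * 'I_n -> {RV P >-> bool}) (W : 'I_n * 'I_n -> {RV P >-> R})
  (model : er_exp_model p X W).
Implicit Types (e : 'I_n * 'I_n) (Q : seq ('I_n * 'I_n)).

Local Notation index := (('I_n * 'I_n) + ('I_n * 'I_n))%type.

Let indices : {set index} := [set i : index |
  match i with inl e => e \in pairs n | inr e => e \in pairs n end]%SET.

Let sigma (i : index) : set (set T) :=
  match i with inl e => sigma_rv (X e) | inr e => sigma_rv (W e) end.

Lemma sigma_measurable i A : sigma i A -> measurable A.
Proof.
by case: i => e [B mB <-]; apply: measurable_funPT.
Qed.

Lemma edge_law e b : e \in pairs n ->
  P (X e @^-1` [set b]) = (if b then p else 1 - p)%:E.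
Proof.
move=> ep; have := er_edge_law model ep [set b].
rewrite /distribution /pushforward /= => ->.
rewrite bernoulli_probE // !diracE.
have inb (a : bool) : (a \in [set b]) = (a == b).
  by apply/idP/eqP => [/set_mem|/mem_set].
by rewrite !inb; case: b {inb}; rewrite /= ?mule0 ?mule1 ?adde0 ?add0e.
Qed.

Lemma weight_law e B : e \in pairs n -> measurable B ->
  P (W e @^-1` B) = exponential_prob 1 B.
Proof. by move=> ep mB; rewrite -(er_weight_law model ep mB). Qed.

Lemma weight_le e (h : R) : e \in pairs n -> 0 < h ->
  P (W e @^-1` `[0, h]) = (1 - expR (- h))%:E.
Proof.
by move=> ep h0; rewrite weight_law // exponential_prob_itv0c // mulN1r.
Qed.

Lemma weight_gt e (h : R) : e \in pairs n -> 0 < h ->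
  P (W e @^-1` (~` `[0, h])) = (expR (- h))%:E.
Proof.
move=> ep h0.
have mA : measurable (W e @^-1` `[0, h]) by exact: measurable_funPTI.
by rewrite preimage_setC probability_setC // weight_le // -EFinB opprB addrC subrK.
Qed.

(* [B (X e t) (W e t)] splits along the value of [X e t] into two intersections
   of independent events, so that independence of the generating variables can
   be applied edge by edge. *)
Definition edges_in (B : bool -> set R) Q : set T :=
  [set t | forall e, e \in Q -> B (X e t) (W e t)].

Lemma measurable_edges_in B Q : (forall b, measurable (B b)) -> measurable (edges_in B Q).
Proof.
move=> mB.
rewrite (_ : edges_in B Q = \bigcap_(e in [set` Q])
  (\bigcup_(b in [set: bool]) (X e @^-1` [set b] `&` W e @^-1` B b))); last first.
  apply/seteqP; split=> t /= h e eQ; first by exists (X e t) => //; split => //; apply: h.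
  by have [b _ [/= -> ]] := h e eQ.
apply: fin_bigcap_measurable => // e _; apply: fin_bigcup_measurable => // b _.
by apply: measurableI; apply: measurable_funPTI.
Qed.

Lemma prob_edges_in (B : bool -> set R) (r0 r1 : R) Q :
    (forall b, measurable (B b)) ->
    (forall e, e \in pairs n -> P (W e @^-1` B false) = r0%:E) ->
    (forall e, e \in pairs n -> P (W e @^-1` B true) = r1%:E) ->
    uniq Q -> {subset Q <= pairs n} ->
  P (edges_in B Q) = (((1 - p) * r0 + p * r1) ^+ size Q)%:E.
Proof.
move=> mB B0 B1.
pose good (J : {set index}) (A : index -> set T) := J \subset indices /\
  (forall i, i \in J -> sigma i (A i)).
have goodm J A : good J A -> measurable (\bigcap_(i in [set` J]) A i).
  move=> [_ h]; apply: fin_bigcap_measurable => // i iJ.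
  by apply: (@sigma_measurable i); apply: h.
(* The induction carries along events [A i] of other variables, so that both events of the next edge
   can be absorbed into [J]. *)
suff main : forall Q' J A, good J A -> uniq Q' -> {subset Q' <= pairs n} ->
    (forall e, e \in Q' -> inl e \notin J /\ inr e \notin J) ->
    P (\bigcap_(i in [set` J]) A i `&` edges_in B Q') =
    ((\prod_(i in J) P (A i)) * (((1 - p) * r0 + p * r1) ^+ size Q')%:E)%E.
  move=> uQ sQ; have := main Q finset.set0 (fun _ => setT) _ uQ sQ _.
  rewrite big_set0 mul1e (_ : [set` finset.set0] = set0); last first.
    by apply/seteqP; split=> i //=; rewrite finset.in_set0.
  rewrite bigcap_set0 setTI; apply => [|e _]; last by rewrite !finset.in_set0.
  by split=> [|i]; rewrite ?finset.sub0set ?finset.in_set0.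
elim=> [|e Q' IH] J A gJ /= => [_ _ _|/andP[eQ' uQ'] sQ dQ].
  rewrite expr0 mule1 (_ : edges_in B [::] = setT) ?setIT; last first.
    by apply/seteqP; split=> t //= _ e.
  by case: gJ => h1 h2; apply: (er_indep model).
have ep : e \in pairs n by apply: sQ; rewrite mem_head.
have [eJ eJ'] := dQ e (mem_head _ _).
pose J' := (inl e |: (inr e |: J))%SET.
pose A' b (i : index) := if i == inl e then X e @^-1` [set b] else
  if i == inr e then W e @^-1` B b else A i.
have A'J b i : i \in J -> A' b i = A i.
  move=> iJ; rewrite /A'; case: eqP => [h|_]; first by rewrite -h iJ in eJ.
  by case: eqP => [h|//]; rewrite -h iJ in eJ'.
have A'l b : A' b (inl e) = X e @^-1` [set b] by rewrite /A' eqxx.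
have A'r b : A' b (inr e) = W e @^-1` B b.
  by rewrite /A'; case: eqP => // _; rewrite eqxx.
have gJ' b : good J' (A' b).
  case: gJ => JD JA; split.
    apply/fintype.subsetP => i; rewrite !finset.in_setU1 => /or3P[/eqP->|/eqP->|iJ].
    - by rewrite inE.
    - by rewrite inE.
    exact: (fintype.subsetP JD).
  move=> i; rewrite !finset.in_setU1 => /or3P[/eqP->|/eqP->|iJ].
  - by rewrite A'l; exists [set b] => //; rewrite setTI.
  - by rewrite A'r; exists (B b) => //; rewrite setTI.
  by rewrite A'J //; exact: JA.
have PA' b : (\prod_(i in J') P (A' b i) = P (X e @^-1` [set b]) *
    (P (W e @^-1` B b) * \prod_(i in J) P (A i)))%E.
  rewrite /J' big_setU1 /=; last by rewrite finset.in_setU1 negb_or eJ.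
  rewrite big_setU1 //= A'l A'r; congr (_ * (_ * _))%E.
  by apply: eq_bigr => i iJ; rewrite A'J.
have capE b : \bigcap_(i in [set` J']) A' b i =
    (X e @^-1` [set b] `&` W e @^-1` B b) `&` \bigcap_(i in [set` J]) A i.
  apply/seteqP; split=> t /=.
    move=> h; split; first split.
    - by have := h (inl e); rewrite /= finset.in_setU1 eqxx A'l; apply.
    - by have := h (inr e); rewrite /= !finset.in_setU1 eqxx orbT A'r; apply.
    move=> i /= iJ; have := h i; rewrite A'J // /=; apply.
    by rewrite !finset.in_setU1 iJ !orbT.
  move=> [[h1 h2] h3] i /=; rewrite !finset.in_setU1 => /or3P[/eqP->|/eqP->|iJ].
  - by rewrite A'l.
  - by rewrite A'r.
  by rewrite A'J //; apply: h3.
have splitE : \bigcap_(i in [set` J]) A i `&` edges_in B (e :: Q') =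
    (\bigcap_(i in [set` J']) A' false i `&` edges_in B Q') `|`
    (\bigcap_(i in [set` J']) A' true i `&` edges_in B Q').
  rewrite !capE; apply/seteqP; split=> t /=.
    move=> [h1 h2]; have he := h2 e (mem_head _ _).
    have hQ f : f \in Q' -> B (X f t) (W f t) by move=> fQ; apply: h2; rewrite inE fQ orbT.
    by case: (X e t) he => he; [right|left].
  by case=> -[[[/= h1 h2] h3] h4]; split=> // f; rewrite inE => /orP[/eqP ->|];
     rewrite ?h1 //; apply: h4.
rewrite splitE.
have dQ' f : f \in Q' -> inl f \notin J' /\ inr f \notin J'.
  move=> fQ; have fe : f != e by apply: contraNneq eQ' => <-.
  have [|h1 h2] := dQ f; first by rewrite inE fQ orbT.
  by rewrite !finset.in_setU1 !negb_or h1 h2 /= !andbT.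
have sQ' : {subset Q' <= pairs n} by move=> f fQ; apply: sQ; rewrite inE fQ orbT.
have HP b := IH J' (A' b) (gJ' b) uQ' sQ' dQ'.
pose U b := \bigcap_(i in [set` J']) A' b i `&` edges_in B Q'.
have mU b : measurable (U b).
  by apply: measurableI; [exact: goodm|exact: measurable_edges_in].
have -> : P (U false `|` U true) = (P (U false) + P (U true))%E.
  apply: measureU => //; rewrite /U !capE; apply/seteqP; split=> t //=.
  by move=> [[[[-> _] _] _] [[[]]]].
rewrite /U !HP.
rewrite !PA' !edge_law // B0 // B1 //.
set pr := (\prod_(i in J) P (A i))%E.
have prf : pr \is a fin_num.
  rewrite /pr; elim/big_rec: _ => // i x iJ xf; rewrite fin_numM //.
  by apply: fin_num_measure; apply: (@sigma_measurable i); case: gJ => _; apply.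
rewrite -(fineK prf) -!EFinM -EFinD exprS; congr (_%:E); ring.
Qed.

(** The value [set0] at [false] forces every pair of [Q] to be an edge, whereas [setT] in
    [prob_edges_heavy] lets absent pairs pass. *)
Lemma prob_edges_light Q (h : R) : 0 < h -> uniq Q -> {subset Q <= pairs n} ->
  P (edges_in (fun b => if b then [set` `[0, h]] else set0) Q) =
    ((p * (1 - expR (- h))) ^+ size Q)%:E.
Proof.
move=> h0 uQ sQ.
rewrite (@prob_edges_in _ 0 (1 - expR (- h))) ?mulr0 ?add0r //.
- by case.
- by move=> e _; rewrite preimage_set0 measure0.
by move=> e ep; exact: weight_le.
Qed.

Lemma prob_edges_heavy Q (h : R) : 0 < h -> uniq Q -> {subset Q <= pairs n} ->
  P (edges_in (fun b => if b then ~` [set` `[0, h]] else setT) Q) =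
    ((1 - p * (1 - expR (- h))) ^+ size Q)%:E.
Proof.
move=> h0 uQ sQ.
rewrite (@prob_edges_in _ 1 (expR (- h))) //.
- by congr ((_ ^+ _)%:E); ring.
- by case => //; apply: measurableC.
- by move=> e _; rewrite preimage_setT probability_setT.
by move=> e ep; exact: weight_gt.
Qed.

Definition edges_of (t : T) : {set 'I_n * 'I_n} := [set e in pairs n | X e t]%SET.

(** Weights are nonnegative only almost surely; the metric lemmas apply outside this null event. *)
Definition nonpos_weight : set T :=
  \bigcup_(e in [set` pairs n]) (W e @^-1` `]-oo, 0]).

Lemma nonpos_weight_null : measurable nonpos_weight /\ P nonpos_weight = 0%E.
Proof.
have [||||] := @union_bound _ _ _ P _ (mem (pairs n)) (fun e => W e @^-1` `]-oo, 0])
   0 #|pairs n|; rewrite /nonpos_weight //.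
- by move=> e _; apply: measurable_funPTI.
- by move=> e ep; rewrite weight_law // exponential_prob_npos.
by move=> m; rewrite mulr0 => P0; split=> //; apply/le_anti; rewrite P0 measure_ge0.
Qed.

Definition unlinked (h : R) (k l : nat) : set T :=
  \bigcup_(S in [set` [pred S : {set 'I_n} * {set 'I_n} |
     [&& #|S.1| == k, #|S.2| == l & [disjoint S.1 & S.2]%B]]])
  edges_in (fun b => if b then ~` [set` `[0, h]] else setT)
    [seq upair u v | u <- enum S.1, v <- enum S.2].

Lemma prob_unlinked h k l : 0 < h -> measurable (unlinked h k l) /\
  (P (unlinked h k l) <=
    (('C(n, k) * 'C(n, l))%:R * (1 - p * (1 - expR (- h))) ^+ (k * l))%:E)%E.
Proof.
move=> h0; apply: union_bound => [S|S||].
- by move=> _; apply: measurable_edges_in; case=> //; apply: measurableC.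
- rewrite inE => /and3P[/eqP S1 /eqP S2 dS].
  rewrite prob_edges_heavy ?size_allpairs -?cardE ?S1 ?S2 //.
    (* Disjointness of the two sets makes the k * l unordered pairs distinct. *)
    apply: allpairs_uniq; rewrite ?enum_uniq //.
    move=> _ _ /allpairsP[[u v] [/= uS vS ->]] /allpairsP[[u' v'] [/= uS' vS' ->]] /=.
    rewrite !mem_enum in uS vS uS' vS'.
    have ne x y : x \in S.1 -> y \in S.2 -> x <> y.
      by move=> xS yS xy; have := disjointFr dS xS; rewrite xy yS.
    rewrite /upair; case: ifP => _; case: ifP => _ [] h1 h2.
    - by rewrite h1 h2.
    - by case: (ne _ _ uS vS').
    - by case: (ne _ _ uS' vS).
    - by rewrite h1 h2.
  move=> _ /allpairsP[[u v] [/= uS vS ->]]; rewrite upair_pairs.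
  rewrite !mem_enum in uS vS; apply/eqP => uv.
  by have := disjointFr dS uS; rewrite uv vS.
- pose A k' := [set S : {set 'I_n} | #|S| == k']%SET.
  rewrite -[n in 'C(n, k)]card_ord -[n in 'C(n, l)]card_ord -!card_draws -cardsX.
  by apply: subset_leq_card; apply/fintype.subsetP => S; rewrite !inE => /and3P[-> -> _].
apply: exprn_ge0; rewrite subr_ge0; case/andP: p01 => p0 p1.
apply: mulr_ile1 => //; first by rewrite subr_ge0 -expR0 ler_expR; lra.
Qed.

(** Larger sets are shrunk to exactly [k] and [l] elements, the sizes over which the union bound
    runs. *)
Lemma linkedP h k l t : ~ unlinked h k l t ->
  linked (light (edges_of t) (fun e => W e t) h) k l.
Proof.
move=> ht S S' dS kS lS.
have sub (A : {set 'I_n}) m : (m <= #|A|)%N -> exists2 B : {set 'I_n}, B \subset A & #|B| = m.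
  move=> /card_geqP[s [us ss sS]].
  exists [set x in s]; first by apply/fintype.subsetP => x; rewrite inE => /sS.
  by rewrite cardsE -ss; apply/card_uniqP.
have [S1 S1S c1] := sub _ _ kS; have [S2 S2S c2] := sub _ _ lS.
apply: contrapT => hn; apply: ht; exists (S1, S2) => /=.
  rewrite inE /= c1 c2 !eqxx /=.
  by apply: disjointWl S1S _; apply: disjointWr S2S _.
move=> _ /allpairsP[[u v] [/= uS vS ->]]; rewrite !mem_enum in uS vS.
have uS' := fintype.subsetP S1S _ uS; have vS' := fintype.subsetP S2S _ vS.
case Xe: (X (upair u v) t) => //= hW; apply: hn; exists u, v; split=> //.
rewrite /adj inE; apply/andP; split; last by move: hW; rewrite in_itv.
rewrite inE upair_pairs Xe andbT.
by apply/eqP => uv; have := disjointFr dS uS'; rewrite uv vS'.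
Qed.

Definition many_light (h : R) (k : nat) : set T :=
  \bigcup_(Q in [set` [pred Q : {set 'I_n * 'I_n} | (Q \subset pairs n) && (#|Q| == k)]])
  edges_in (fun b => if b then [set` `[0, h]] else set0) (enum Q).

Lemma prob_many_light h k : 0 < h -> measurable (many_light h k) /\
  (P (many_light h k) <=
    ('C(n * n, k)%:R * (p * (1 - expR (- h))) ^+ k)%:E)%E.
Proof.
move=> h0; apply: union_bound => [Q|Q||].
- by move=> _; apply: measurable_edges_in; case.
- rewrite inE => /andP[/fintype.subsetP Qs /eqP <-].
  rewrite prob_edges_light ?enum_uniq -?cardE //.
  by move=> e; rewrite mem_enum; exact: Qs.
- have <- : #|{: 'I_n * 'I_n}| = (n * n)%N by rewrite card_prod !card_ord.
  rewrite -card_draws; apply: subset_leq_card; apply/fintype.subsetP => Q.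
  by rewrite !inE => /andP[].
apply: exprn_ge0; case/andP: p01 => p0 p1; apply: mulr_ge0 => //.
by rewrite subr_ge0 -expR0 ler_expR; lra.
Qed.

(** The event puts weights in [0, h] while the count has no lower limit; excluding [nonpos_weight]
    reconciles the two. *)
Lemma many_lightP h k t : ~ nonpos_weight t -> ~ many_light h k t ->
  (#|[set e in edges_of t | (W e t <= h)%R]%SET| < k)%N.
Proof.
move=> tN ht; rewrite ltnNge; apply/negP => /card_geqP[s [us ss sS]].
apply: ht; exists [set e in s]%SET.
  rewrite /= inE; apply/andP; split.
    by apply/fintype.subsetP => e; rewrite inE => /sS; rewrite !inE => /andP[/andP[]].
  by rewrite cardsE -ss; apply/eqP/card_uniqP.
move=> e; rewrite mem_enum inE => /sS; rewrite !inE => /andP[/andP[ep Xe] We].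
rewrite Xe /= in_itv /= We andbT leNgt; apply/negP => We0.
by apply: tN; exists e; [rewrite /= inE|rewrite /= in_itv /= ltW].
Qed.

End Model.

(** * Failure probabilities *)

Lemma ffact_le_expn n b : (n ^_ b <= n ^ b)%N.
Proof.
elim: b n => [|b IH] n; first by rewrite ffactn0.
case: n => [|n]; first by rewrite ffact0n.
rewrite ffactSS expnS leq_mul2l /=; apply: leq_trans (IH _) _.
by case: b {IH} => // b; rewrite leq_exp2r.
Qed.

Section Estimates.
Context (R : realType).
Implicit Types (x y q : R).

(** Induction on [b], using (1 + 1/b)^b <= e. *)
Lemma expR_factorial b : (b%:R : R) ^+ b <= b`!%:R * expR b%:R.
Proof.
elim: b => [|b IH]; first by rewrite expr0 fact0 mul1r expR0.
have [->|b0] := posnP b.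
  by rewrite expr1 (_ : 1`! = 1%N) // mul1r; apply: le_trans (expR_ge1Dx _); lra.
have bR : 0 < b%:R :> R by rewrite ltr0n.
have h : (b.+1%:R : R) ^+ b <= expR 1 * b%:R ^+ b.
  rewrite -ler_pdivrMr ?exprn_gt0 // -expr_div_n.
  apply: (@le_trans _ _ (expR b%:R^-1 ^+ b)).
    apply: lerXn2r; rewrite ?nnegrE ?divr_ge0 ?expR_ge0 //.
    apply: le_trans (expR_ge1Dx _); rewrite -addn1 natrD mulrDl divff ?lt0r_neq0 //.
    by rewrite mul1r.
  by rewrite -expRM_natr mulVf // lt0r_neq0.
rewrite exprS factS natrM -[b.+1 in X in expR X]addn1 natrD expRD -!mulrA.
rewrite ler_pM2l ?ltr0n //; apply: (le_trans h).
by rewrite mulrC [X in _ <= X]mulrA ler_wpM2r // expR_ge0.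
Qed.

Lemma bin_le_exprn n b : ('C(n, b)%:R : R) <= n%:R ^+ b.
Proof.
rewrite -natrX ler_nat; apply: (@leq_trans (n ^_ b)).
  by rewrite -bin_ffact leq_pmulr // fact_gt0.
exact: ffact_le_expn.
Qed.

(** The binomial is at most n^b / b!, and b! >= (b / e)^b; [x] stands for an upper bound on n /
    b. *)
Lemma bin_le_entropy n b x : (0 < b)%N -> n%:R <= b%:R * x ->
  'C(n, b)%:R <= (expR 1 * x) ^+ b.
Proof.
move=> b0 nx; have bR : 0 < b%:R :> R by rewrite ltr0n.
have h1 : ('C(n, b)%:R * b`!%:R : R) <= n%:R ^+ b.
  by rewrite -natrM bin_ffact -natrX ler_nat ffact_le_expn.
have h2 := expR_factorial b.
have fR : 0 < b`!%:R :> R by rewrite ltr0n fact_gt0.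
have h3 : (n%:R : R) ^+ b <= b%:R ^+ b * x ^+ b.
  by rewrite -exprMn; apply: lerXn2r; rewrite ?nnegrE // (le_trans _ nx).
have x0 : 0 <= x by rewrite -(pmulr_rge0 _ bR) (le_trans _ nx).
rewrite exprMn -expRM_natr mul1r -(ler_pM2r fR).
apply: (le_trans h1); apply: (le_trans h3).
rewrite [X in _ <= X]mulrC mulrA; apply: ler_wpM2r => //; exact: exprn_ge0.
Qed.

(* [x <= exp (x - 1)] turns the entropy factor into a plain exponential. *)
Lemma bin_le_expR n b y (i : nat) : (0 < b)%N -> 0 <= y -> n%:R <= b%:R * y ^+ i.+1 ->
  'C(n, b)%:R <= expR (b%:R * (i.+1%:R * y)).
Proof.
move=> b0 y0 /(bin_le_entropy b0) h; apply: (le_trans h).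
rewrite [b%:R * _]mulrC expRM_natr; apply: lerXn2r; rewrite ?nnegrE ?expR_ge0 //.
  by rewrite mulr_ge0 ?expR_ge0 ?exprn_ge0.
have -> : i.+1%:R * y = 1 + (i.+1%:R * (y - 1) + i%:R).
  by rewrite -addn1 natrD; ring.
rewrite expRD ler_pM2l ?expR_gt0 //.
apply: (@le_trans _ _ (expR (i.+1%:R * (y - 1)))); last by rewrite ler_expR lerDl.
rewrite mulrC expRM_natr; apply: lerXn2r; rewrite ?nnegrE ?expR_ge0 //.
by apply: le_trans (expR_ge1Dx _); lra.
Qed.

(** From exp (- x) <= 1 / (1 + x) one gets the lower bound x / (1 + x), and 1 + x <= 9. *)
Lemma one_sub_expR_ge x : 0 <= x -> x <= 8 -> x / 9 <= 1 - expR (- x).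
Proof.
move=> x0 x8; have h := expR_ge1Dx x; have h1 : 0 < 1 + x by lra.
have : expR (- x) <= (1 + x)^-1.
  by rewrite expRN lef_pV2 ?posrE ?expR_gt0.
suff : x / 9 <= 1 - (1 + x)^-1 by lra.
have -> : 1 - (1 + x)^-1 = x / (1 + x) by field; lra.
by apply: ler_wpM2l => //; rewrite lef_pV2 ?posrE; lra.
Qed.

Lemma expr_one_sub_le q (y : R) m : 0 <= 1 - q -> y <= q -> (1 - q) ^+ m <= expR (- (y * m%:R)).
Proof.
move=> q1 yq; rewrite -mulNr expRM_natr; apply: lerXn2r; rewrite ?nnegrE ?expR_ge0 //.
by apply: le_trans (expR_ge1Dx _); lra.
Qed.

End Estimates.

(* At edge density of order [z ^ 2 / n], a set of [n / z ^ i.+2] vertices has at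
   least [n / z ^ i.+1] neighbours: the entropy of the two sets, of order
   [z * n / z ^ i.+1], is beaten by [z ^ 2 * n / z ^ i.+2]. *)
Definition block (n z i : nat) : nat := (n %/ z ^ i.+1).+1.

(** Stage 0 joins two sets of the largest block size; by [nbhd_linked], stage j + 1 makes block j +
    1 grow to block j. *)
Definition coblock (n z i : nat) : nat :=
  if i is j.+1 then (n - block n z j)%N else block n z 0.

Section Blocks.
Context (R : realType) (n z : nat) (z8 : (8 <= z)%N).

Lemma block_ge i : (n%:R : R) <= (block n z i)%:R * z%:R ^+ i.+1.
Proof.
rewrite -natrX -natrM ler_nat ltnW // /block.
by rewrite ltn_ceil // expn_gt0; case: z z8.
Qed.

Lemma block_le i : (z ^ i.+1 <= n)%N ->
  (block n z i)%:R * z%:R ^+ i.+1 <= 2 * n%:R :> R.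
Proof.
move=> zn; rewrite -natrX -natrM -(natrM R 2) ler_nat /block mulSn mul2n -addnn.
by rewrite leq_add // leq_divM.
Qed.

Lemma block_step i : ((block n z i)%:R : R) <= 2 * z%:R * (block n z i.+1)%:R.
Proof.
have zR : 8 <= z%:R :> R by rewrite (ler_nat R 8).
have zi : 0 < (z%:R : R) ^+ i.+1 by rewrite exprn_gt0 //; lra.
have h : ((block n z i)%:R : R) * z%:R ^+ i.+1 <= n%:R + z%:R ^+ i.+1.
  rewrite -natrX -natrM -natrD ler_nat /block mulSn addnC leq_add2r.
  by rewrite leq_divM.
have := block_ge i.+1; rewrite exprS mulrA => h'.
have b1 : 1 <= (block n z i.+1)%:R :> R by rewrite ler1n.
have : (block n z i)%:R <= (block n z i.+1)%:R * z%:R + 1 :> R.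
  rewrite -(ler_pM2r zi) mulrDl mul1r; lra.
nra.
Qed.

Lemma block_le_quarter i : (z ^ i.+1 <= n)%N -> (block n z i)%:R <= n%:R / 4 :> R.
Proof.
move=> zn; have h := block_le zn.
have zR : 8 <= z%:R :> R by rewrite (ler_nat R 8).
have : 8 <= z%:R ^+ i.+1 :> R.
  have z1 : 1 <= z%:R :> R by lra.
  by have := exprn_ege1 i z1; rewrite exprS; nra.
have : 0 <= (block n z i)%:R :> R by [].
nra.
Qed.

Lemma block_leq i : (z ^ i.+1 <= n)%N -> (block n z i <= n)%N.
Proof.
move=> /block_le_quarter h; rewrite -(ler_nat R).
by apply: le_trans h _; have := ler0n R n; lra.
Qed.

End Blocks.

Section FailureProbabilities.
Context (n : nat) (d : measure_display) (T : measurableType d) (R : realType)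
  (P : probability T R) (p : R) (p01 : 0 <= p <= 1)
  (X : 'I_n * 'I_n -> {RV P >-> bool}) (W : 'I_n * 'I_n -> {RV P >-> R})
  (model : er_exp_model p X W).

(** [a] and [b] bound the entropies of the two sets, [q] bounds from below the probability that a
    pair is a light edge, and [c] is the remaining margin. *)
Lemma prob_unlinked_le h q k l a b c : 0 < h <= 8 -> q * n%:R <= p * h / 9 * n%:R ->
    (0 < n)%N -> 'C(n, k)%:R <= expR a -> 'C(n, l)%:R <= expR b ->
    a + b + c <= q * k%:R * l%:R ->
  measurable (unlinked X W h k l) /\ (P (unlinked X W h k l) <= (expR (- c))%:E)%E.
Proof.
move=> /andP[h0 h8] qh n0 ka lb abc.
have [mU PU] := prob_unlinked p01 model k l h0; split=> //.
apply: le_trans PU _; rewrite lee_fin natrM.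
have [p0 p1] := andP p01.
have q9 : q <= p * (1 - expR (- h)).
  have : q <= p * h / 9 by move: qh; rewrite ler_pM2r // ltr0n.
  have := one_sub_expR_ge (ltW h0) h8; nra.
have q1 : 0 <= 1 - p * (1 - expR (- h)).
  have := expR_gt0 (- h); have : 0 <= 1 - expR (- h) by rewrite subr_ge0 -expR0 ler_expR; lra.
  nra.
have := expr_one_sub_le (k * l) q1 q9; rewrite natrM => h1.
apply: (@le_trans _ _ (expR a * expR b * expR (- (q * (k%:R * l%:R))))).
  by apply: ler_pM; rewrite ?mulr_ge0 ?exprn_ge0 //; apply: ler_pM.
by rewrite -!expRD ler_expR; lra.
Qed.

Definition stage_failure (h : R) (z : nat) : set T :=
  \bigcup_(i in [set` predT : pred 'I_4]) unlinked X W h (block n z i) (coblock n z i).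

Lemma prob_stage_failure h z c : (8 <= z)%N -> (z ^ 4 <= n)%N -> 0 <= c ->
    c * z%:R ^+ 4 <= n%:R -> 0 < h <= 8 -> 20 * z%:R ^+ 2 <= p * h / 9 * n%:R ->
  measurable (stage_failure h z) /\
  (P (stage_failure h z) <= (4 * expR (- c))%:E)%E.
Proof.
move=> z8 z4 c0 cz h8 ph.
have n0 : (0 < n)%N by apply: leq_trans z4; rewrite expn_gt0 (leq_trans _ z8).
have nR : 0 < n%:R :> R by rewrite ltr0n.
have zR : 8 <= z%:R :> R by rewrite (ler_nat R 8).
suff main (i : 'I_4) : measurable (unlinked X W h (block n z i) (coblock n z i)) /\
    (P (unlinked X W h (block n z i) (coblock n z i)) <= (expR (- c))%:E)%E.
  apply: union_bound => [i _|i _||]; [by case: (main i)|by case: (main i)| |exact: expR_ge0].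
  by apply: leq_trans (max_card _) _; rewrite card_ord.
pose q : R := 20 * z%:R ^+ 2 / n%:R.
have qh : q * n%:R <= p * h / 9 * n%:R by rewrite /q divfK ?lt0r_neq0.
have zn j : (j < 4)%N -> (z ^ j.+1 <= n)%N.
  by move=> j4; apply: leq_trans z4; rewrite leq_exp2l //; apply: leq_trans z8.
(* Every block has at least [c] elements, so a term linear in the block size pays for the margin. *)
have cb j : (j < 4)%N -> c <= (block n z j)%:R.
  move=> j4; have zj : 0 < (z%:R : R) ^+ j.+1 by rewrite exprn_gt0; lra.
  rewrite -(ler_pM2r zj); apply: le_trans (block_ge R n z8 j).
  apply: le_trans cz; apply: ler_wpM2l => //.
  by rewrite -!natrX ler_nat leq_exp2l //; apply: leq_trans z8.
have bin j : 'C(n, block n z j)%:R <= expR ((block n z j)%:R * (j.+1%:R * z%:R)) :> R.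
  by apply: bin_le_expR; rewrite // (block_ge R n z8).
case: i => -[|j] /= j4.
  apply: prob_unlinked_le qh n0 (bin 0%N) (bin 0%N) _ => //.
  (* Since x z >= n, the exponent is at least 20 z x, against entropies 2 z x and a margin c <=
     x. *)
  have := cb 0%N isT; have := block_ge R n z8 0%N; rewrite expr1 mul1r.
  set x := (block n z 0)%:R => h1 h2.
  have -> : q * x * x = 20 * z%:R * x * (x * z%:R / n%:R).
    by rewrite /q; field; rewrite lt0r_neq0.
  have : 1 <= x * z%:R / n%:R by rewrite ler_pdivlMr // mul1r.
  have x0 : 0 <= x by lra.
  have : 0 <= z%:R * x by nra.
  set y := x * z%:R / n%:R => h3 h4.
  have h5 : 20 * (z%:R * x) <= 20 * z%:R * x * y by nra.
  have h6 : 8 * x <= z%:R * x by nra.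
  lra.
have j4' : (j < 4)%N by apply: ltnW.
have bj := bin j; rewrite -bin_sub in bj; last exact: (block_leq R z8 (zn _ j4')).
apply: (prob_unlinked_le h8 qh n0 (bin j.+1) bj).
rewrite natrB; last exact: (block_leq R z8 (zn _ j4')).
(* As y <= n / 4, the exponent is at least 15 z^2 x. The entropies are at most 4 z x and, by y <= 2
   z x, 6 z^2 x. *)
have := cb _ j4; have := block_step R n z8 j; have := block_le_quarter R z8 (zn _ j4').
set x := (block n z j.+1)%:R; set y := (block n z j)%:R => h1 h2 h3.
have x0 : 0 <= x by lra.
have y0 : 0 <= y by rewrite /y.
have -> : q * x * (n%:R - y) = 20 * z%:R ^+ 2 * x * (1 - y / n%:R).
  by rewrite /q; field; rewrite lt0r_neq0.
have yn : y / n%:R <= 4^-1 by rewrite ler_pdivrMr //; lra.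
have jR : j.+1%:R <= 3 :> R by rewrite (ler_nat R _ 3).
have jR2 : j.+2%:R <= 4 :> R by rewrite (ler_nat R _ 4).
have h4 : 15 * (z%:R ^+ 2 * x) <= 20 * z%:R ^+ 2 * x * (1 - y / n%:R).
  have : 0 <= z%:R ^+ 2 * x by rewrite mulr_ge0 // exprn_ge0; lra.
  set w := z%:R ^+ 2 * x => w0; rewrite -[20 * _ * x]mulrA -/w; nra.
have h5 : x * (j.+2%:R * z%:R) <= 4 * (z%:R * x).
  have : 0 <= z%:R * x by nra.
  nra.
have h6 : y * (j.+1%:R * z%:R) <= 6 * (z%:R ^+ 2 * x).
  apply: (@le_trans _ _ (y * (3 * z%:R))); first by apply: ler_wpM2l => //; nra.
  by rewrite expr2; nra.
have h7 : 8 * (z%:R * x) <= z%:R ^+ 2 * x by rewrite expr2; nra.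
have h8' : 8 * x <= z%:R * x by nra.
lra.
Qed.

(** Writes m + 1 - 2k as m - (2k - 1), so that symmetry of binomials yields the entropy of 2k - 1
    elements. *)
Lemma double_pred_sub k m : (0 < k)%N -> (k * 10 <= m)%N ->
  [/\ (m.+1 - k.*2 = m - k.*2.-1)%N, (k.*2.-1 <= m)%N, (k.*2 <= m.+1)%N &
      (k.*2.-1.+1 = k.*2)%N].
Proof. by move=> *; split; lia. Qed.

Definition terminal_size := (n %/ 10).+1.

Definition terminal_failure (h : R) : set T :=
  (\bigcup_(k in [set` [pred k : 'I_terminal_size | (0 < k)%N]])
     unlinked X W h k (n.+1 - k.*2)) `|`
  unlinked X W h terminal_size terminal_size.

Lemma prob_terminal_failure h : 50 <= ln n%:R :> R -> 0 < h <= 8 ->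
    8 * ln n%:R <= p * h / 9 * n%:R ->
  measurable (terminal_failure h) /\
  (P (terminal_failure h) <= (2 / n%:R)%:E)%E.
Proof.
set L := ln n%:R => L50 h8 ph.
have n0 : (0 < n)%N.
  by rewrite lt0n; apply/eqP => n0; move: L50; rewrite /L n0 ln0 //; lra.
have nR : 0 < n%:R :> R by rewrite ltr0n.
have eL : expR L = n%:R by rewrite lnK.
have Ln : L <= n%:R by have := expR_ge1Dx L; rewrite eL; lra.
pose q : R := 8 * L / n%:R.
have qh : q * n%:R <= p * h / 9 * n%:R by rewrite /q divfK ?lt0r_neq0.
have bin k : 'C(n, k)%:R <= expR (k%:R * L) :> R.
  by rewrite mulrC expRM_natr eL; exact: bin_le_exprn.
have h1 k : (0 < k < terminal_size)%N ->
    measurable (unlinked X W h k (n.+1 - k.*2)) /\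
    (P (unlinked X W h k (n.+1 - k.*2)) <= (expR (- (2 * L)))%:E)%E.
  rewrite /terminal_size => /andP[k0 kn].
  have k10 : (k * 10 <= n)%N by rewrite -leq_divRL.
  have [e e1 e2 e3] := double_pred_sub k0 k10.
  have bk := bin k.*2.-1; rewrite -(bin_sub e1) -e in bk.
  apply: (prob_unlinked_le h8 qh n0 (bin k) bk).
  have e4 : (k.*2.-1)%:R = 2 * k%:R - 1 :> R.
    have : (k.*2.-1)%:R + 1 = 2 * k%:R :> R by rewrite natr1 e3 -mul2n natrM.
    by move=> <-; ring.
  rewrite e natrB // e4.
  have k10R : k%:R * 10 <= n%:R :> R by rewrite -natrM ler_nat.
  have k1R : 1 <= k%:R :> R by rewrite ler1n.
  set x := k%:R in k10R k1R *.
  (* As 2x - 1 <= n / 5, this is at least 6.4 L x, while entropies and margin sum to (3x + 1) L <= 4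
     L x. *)
  have -> : q * x * (n%:R - (2 * x - 1)) = 8 * (L * x) * (1 - (2 * x - 1) / n%:R).
    by rewrite /q; field; rewrite lt0r_neq0.
  have : (2 * x - 1) / n%:R <= 5^-1 by rewrite ler_pdivrMr //; lra.
  have : L <= L * x by nra.
  have : 0 <= L * x by nra.
  set y := (2 * x - 1) / n%:R; set w := L * x => w0 hw hy.
  have : 8 * w * (4 / 5) <= 8 * w * (1 - y) by nra.
  have -> : x * L = w by rewrite mulrC.
  have -> : (2 * x - 1) * L = 2 * w - L by rewrite /w; ring.
  lra.
have h2 : measurable (unlinked X W h terminal_size terminal_size) /\
    (P (unlinked X W h terminal_size terminal_size) <= (expR (- L))%:E)%E.
  have tn : (n%:R : R) <= terminal_size%:R * 10 ^+ 1.
    by rewrite expr1 -natrM ler_nat ltnW // /terminal_size ltn_ceil.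
  have bt := bin_le_expR (_ : (0 < terminal_size)%N) (ler0n R 10) tn.
  apply: (prob_unlinked_le h8 qh n0 (bt isT) (bt isT)).
  (* Both entropies are 10 x, and L <= n <= 10 x; the total 30 x is below 0.8 L x because L >=
     50. *)
  move: tn; rewrite expr1 mul1r; set x := terminal_size%:R => tn.
  have x0 : 0 < x by rewrite /x ltr0n.
  have -> : q * x * x = 8 * L * x * (x / n%:R) by rewrite /q; field; rewrite lt0r_neq0.
  have : 10^-1 <= x / n%:R by rewrite ler_pdivlMr //; lra.
  set y := x / n%:R => hy.
  have : 50 * x <= L * x by nra.
  set w := L * x => hw; have -> : 8 * L * x * y = 8 * w * y by rewrite /w; ring.
  have : 8 * w * 10^-1 <= 8 * w * y by nra.
  lra.
have [||||m1 P1] := @union_bound _ _ _ P _ [pred k : 'I_terminal_size | (0 < k)%N]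
    (fun k => unlinked X W h k (n.+1 - k.*2)) (expR (- (2 * L))) n.
- by move=> k k0; have [] := h1 k _; rewrite // ltn_ord andbT.
- by move=> k k0; have [] := h1 k _; rewrite // ltn_ord andbT.
- apply: (leq_trans (max_card _)); rewrite card_ord /terminal_size.
  by rewrite ltn_Pdiv.
- exact: expR_ge0.
have [m2 P2] := h2; split; first exact: measurableU.
apply: (@le_trans _ _ (n%:R * expR (- (2 * L)) + expR (- L))%:E).
  by rewrite EFinD; apply: le_trans (leeD P1 P2); exact: measureU2.
rewrite lee_fin !expRN eL [2 * L]mulrC expRM_natr eL.
have -> : n%:R * (n%:R ^+ 2)^-1 = n%:R^-1 :> R by field; rewrite lt0r_neq0.
lra.
Qed.

(** Chosen so that the entropy factor 8 e n per edge, times [p] and the threshold, equals exp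
    (-1). *)
Definition light_threshold : R := expR (- 2) / (8 * n%:R * p).

Lemma prob_light_failure : (0 < n)%N -> 0 < p ->
  measurable (many_light X W light_threshold (n %/ 8).+1) /\
  (P (many_light X W light_threshold (n %/ 8).+1) <= (expR (- (n%:R / 8)))%:E)%E.
Proof.
move=> n0 p0; have nR : 0 < n%:R :> R by rewrite ltr0n.
have t0 : 0 < light_threshold.
  by rewrite /light_threshold divr_gt0 ?expR_gt0 // !mulr_gt0.
have [m Pm] := prob_many_light p01 model (n %/ 8).+1 t0; split=> //.
apply: (le_trans Pm); rewrite lee_fin; set k := (n %/ 8).+1.
have k8 : (n%:R : R) <= k%:R * 8 by rewrite -natrM ler_nat ltnW // /k ltn_ceil.
have := @bin_le_entropy R (n * n) k (8 * n%:R) isT.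
rewrite natrM mulrA => /(_ (ler_wpM2r (ltW nR) k8)) hb.
have pt : p * (1 - expR (- light_threshold)) <= p * light_threshold.
  by rewrite ler_pM2l //; have := expR_ge1Dx (- light_threshold); lra.
have pt0 : 0 <= p * (1 - expR (- light_threshold)).
  by rewrite mulr_ge0 ?(ltW p0) // subr_ge0 -expR0 ler_expR; lra.
apply: (@le_trans _ _ ((expR 1 * (8 * n%:R)) ^+ k * (p * light_threshold) ^+ k)).
  by apply: ler_pM; rewrite ?exprn_ge0 //; apply: lerXn2r; rewrite ?nnegrE // (le_trans pt0).
rewrite -exprMn.
have -> : expR 1 * (8 * n%:R) * (p * light_threshold) = expR (-1) :> R.
  have -> : -1 = 1 - 2 :> R by ring.
  rewrite expRD /light_threshold; field.
  by rewrite !lt0r_neq0.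
by rewrite -expRM_natr ler_expR; lra.
Qed.

End FailureProbabilities.

(** * Bounds for a fixed number of vertices *)

Section CostBounds.
Context (R : realType) (n : nat).

(** The second conclusion keeps the induction going when [y] exceeds the last level; the excess is
    charged separately to the diameter. *)
Lemma layer_cake_le (r : nat -> R) (y : R) (a j : nat) :
    (forall z, r z <= r z.+1) ->
  let s := r a + \sum_(a <= z < a + j) (r z.+1 - r z) * (r z < y)%R%:R in
  (y <= r (a + j)%N -> y <= s) /\ (r (a + j)%N < y -> r (a + j)%N <= s).
Proof.
move=> r_mono; elim: j => [|j IH] /=; first by rewrite addn0 big_geq // addr0.
rewrite addnS big_nat_recr /= ?leq_addr // addrA.
set s := _ + \sum_(_ <= _ < _) _ in IH *.
have := r_mono (a + j)%N; move: IH => /=.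
case: (ltP (r (a + j)%N) y) => h1 /= [h2 h3] h4; rewrite ?mulr1 ?mulr0.
  by have := h3 isT; split; lra.
by have := h2 isT; split; lra.
Qed.

(** The edges longer than [r z] are as many as some set of vertices at pairwise distance more than
    [r z], hence at most [c z]. Edges beyond the last level are charged [rmax] each. *)
Lemma greedy_layer_cake (d : 'I_n -> 'I_n -> \bar R) (M : {set 'I_n * 'I_n})
    (r c : nat -> R) (rmax : R) (a j : nat) :
    (forall u v, (0 <= d u v)%E) -> (forall u v, d u v = d v u) ->
    (forall z, r z <= r z.+1) -> 0 <= r a -> 0 <= rmax ->
    (forall u v, (d u v <= rmax%:E)%E) ->
    (forall z (S : {set 'I_n}), (a <= z <= a + j)%N ->
       (forall u v, u \in S -> v \in S -> u != v -> ((r z)%:E < d u v)%E) ->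
       #|S|%:R <= c z) ->
    greedy_run d M ->
  (matching_cost d M <= (#|M|%:R * r a +
     \sum_(a <= z < a + j) (r z.+1 - r z) * c z + rmax * c (a + j)%N)%:E)%E.
Proof.
move=> d_ge0 d_sym r_mono ra0 rmax0 d_max sep gM.
have dfin u v : d u v \is a fin_num.
  by rewrite ge0_fin_numE // (le_lt_trans (d_max u v)) // ltry.
pose w (e : 'I_n * 'I_n) := fine (d e.1 e.2).
have wE (e : 'I_n * 'I_n) : d e.1 e.2 = (w e)%:E by rewrite fineK.
have heavy z : (a <= z <= a + j)%N -> \sum_(e in M) (r z < w e)%R%:R <= c z.
  move=> zaj; have [S cS sS] := greedy_heavy_separated d_sym (r z)%:E gM.
  apply: le_trans (sep z S zaj sS); rewrite cS -sum1_card natr_sum.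
  rewrite big_mkcond [leRHS]big_mkcond le_eqVlt; apply/orP; left.
  apply/eqP/eq_bigr => e _ /=.
  rewrite inE wE lte_fin; case: (e \in M) => //=.
  by case: (r z < w e).
rewrite /matching_cost (eq_bigr (fun e => (w e)%:E)) // sumEFin lee_fin.
apply: (@le_trans _ _ (\sum_(e in M) (r a +
    \sum_(a <= z < a + j) (r z.+1 - r z) * (r z < w e)%R%:R +
    rmax * (r (a + j)%N < w e)%R%:R))).
  apply: ler_sum => e _; have /= := layer_cake_le (w e) a j r_mono.
  have : w e <= rmax by rewrite -lee_fin -wE.
  set s := \sum_(_ <= _ < _) _.
  have s0 : 0 <= s.
    by apply: sumr_ge0 => z _; rewrite mulr_ge0 ?subr_ge0 //; case: ltP.
  case: (ltP (r (a + j)%N) (w e)) => h1 h2 [h3 h4] /=.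
    by rewrite mulr1; lra.
  by rewrite mulr0 addr0; exact: h3.
rewrite !big_split /= sumr_const -[r a *+ _]mulr_natl lerD //; last first.
  by rewrite -mulr_sumr ler_wpM2l //; apply: heavy; rewrite leq_addr leqnn.
rewrite lerD2l exchange_big /=; apply: ler_sum_nat => z /andP[az zj].
by rewrite -mulr_sumr ler_wpM2l ?subr_ge0 //; apply: heavy; rewrite az ltnW.
Qed.

End CostBounds.

Lemma approx_ratio_le (R : realType) (x y : \bar R) (a b : R) : (0 <= x)%E ->
  (x <= a%:E)%E -> 0 < b -> (b%:E <= y)%E -> (approx_ratio x y <= (a / b)%:E)%E.
Proof.
move=> x0 xa b0 yb; rewrite /approx_ratio.
have xf : x \is a fin_num by rewrite ge0_fin_numE // (le_lt_trans xa) // ltry.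
rewrite -(fineK xf) /= in x0 xa *; set x' := fine x in x0 xa *.
rewrite !lee_fin in x0 xa; have a0 := le_trans x0 xa.
case: y yb => [y| |]; last by rewrite leeNy_eq.
  rewrite lee_fin => yb; have y0 := lt_le_trans b0 yb.
  rewrite inver gt_eqF // -EFinM lee_fin; apply: ler_pM => //.
    by rewrite invr_ge0 ltW.
  by rewrite lef_pV2 ?posrE.
by move=> _; rewrite invey mule0 lee_fin divr_ge0 // ltW.
Qed.

Lemma approx_ratio_le_greedy (R : realType) (x y : \bar R) (k : R) : 1 <= k ->
    (0 <= y)%E -> (y <= x)%E -> (x <= k%:E * y)%E ->
  (approx_ratio x y <= k%:E)%E.
Proof.
move=> k1 y0 yx xky; rewrite /approx_ratio.
case: y y0 yx xky => [y| |] //.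
  rewrite andbF -EFinM lee_fin => y0 yx xky.
  have xf : x \is a fin_num.
    by rewrite ge0_fin_numE ?(le_trans _ yx) ?lee_fin // (le_lt_trans xky) ?ltry.
  rewrite -(fineK xf) /= in xky *; rewrite lee_fin in xky.
  (* A zero optimum forces a zero greedy cost, and 0 / 0 evaluates to 0. *)
  have [y00|yn0] := eqVneq y 0.
    have : x = 0%E.
      apply/le_anti; rewrite -(fineK xf) !lee_fin; move: xky yx.
      by rewrite y00 mulr0 -(fineK xf) lee_fin => -> ->.
    by move=> ->; rewrite mul0e lee_fin; lra.
  have y1 : 0 < y by rewrite lt_neqAle eq_sym yn0.
  by rewrite inver (negbTE yn0) -EFinM lee_fin ler_pdivrMr.
by move=> _; rewrite leye_eq => /eqP -> _; rewrite eqxx /= lee_fin.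
Qed.

(** At most n / 4 of the n / 2 matched pairs are shorter than [theta], by [light_edges_incident];
    the others cost at least [theta] each. *)
Lemma min_matching_cost_ge (R : realType) (n : nat) (E : {set 'I_n * 'I_n})
    (w : 'I_n * 'I_n -> R) (theta : R) :
    (forall e, e \in E -> 0 <= w e) -> 0 <= theta ->
    (#|[set e in E | (w e <= theta)%R]%SET| < (n %/ 8).+1)%N ->
  ((theta * (n%:R / 4))%:E <= min_matching_cost (sp_dist E w))%E.
Proof.
move=> w0 t0 L; apply: le_ereal_inf_tmp => _ [M /= pM <-].
have := light_edges_incident w0 theta pM.
set H := [set e in M | _]%SET => HL.
have H4 : (#|H| * 4 <= n)%N.
  have h8 : (n %/ 8 * 8 <= n)%N := leq_divM n 8.
  have h : (#|H| <= (n %/ 8).*2)%N by apply: leq_trans HL _; rewrite leq_double -ltnS.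
  apply: leq_trans h8; rewrite -[8%N]/(2 * 4)%N mulnA leq_mul2r /=.
  by rewrite muln2.
have HM : H \subset M by apply/fintype.subsetP => e; rewrite inE => /andP[].
rewrite /matching_cost (bigID (mem H)) /=.
apply: (@le_trans _ _ (\sum_(e in M | e \notin H) theta%:E)%E); last first.
  apply: (@le_trans _ _ (\sum_(e in M | e \notin H) sp_dist E w e.1 e.2)%E).
    by apply: lee_sum => e /andP[eM]; rewrite inE eM /= -leNgt.
  by rewrite leeDr // sume_ge0 // => e _; exact: sp_dist_ge0.
rewrite sumEFin lee_fin sumr_const -[theta *+ _]mulr_natr ler_wpM2l //.
have -> : #|[pred e in M | e \notin H]| = (#|M| - #|H|)%N.
  rewrite -[in RHS](finset.setIidPr HM) -cardsD; apply: eq_card => e.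
  by rewrite finset.in_setD inE /= andbC.
rewrite natrB; last exact: subset_leq_card.
have : #|M|%:R * 2 = n%:R :> R by rewrite -natrM muln2 perfect_matching_card.
have : #|H|%:R * 4 <= n%:R :> R by rewrite -natrM ler_nat.
lra.
Qed.

(* [f] may fail to be measurable: the integral of its positive part is by
   construction a supremum over the simple functions below it. *)
Lemma integral_le_majorant d (T : measurableType d) (R : realType)
    (P : probability T R) (f g : T -> \bar R) :
  (forall t, 0 <= g t)%E -> (forall t, f t <= g t)%E -> (\int[P]_t f t <= \int[P]_t g t)%E.
Proof.
move=> g0 fg; rewrite [leRHS]ge0_integralTE // integralE.
apply: (@le_trans _ _ (\int[P]_t (f^\+ t))%E).
  rewrite -[leRHS]adde0; apply: leeD2l; rewrite oppe_le0.
  by apply: integral_ge0 => t _; exact: funeneg_ge0.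
rewrite ge0_integralTE //; apply: le_ereal_sup => _ [h /= hf <-].
exists h => //= x; apply: le_trans (hf x) _; by rewrite funeposE ge_max fg g0.
Qed.

(** The numerator is the increment of x^2, coming from consecutive radii; the right-hand side
    telescopes. *)
Lemma layer_term_le (R : realType) (x : R) : 8 <= x ->
  (2 * x + 1) / x ^+ 4 <= 3 * ((x - 1)^-1 - x^-1).
Proof.
move=> x8.
have x0 : 0 < x by lra.
have x1 : 0 < x - 1 by lra.
have -> : (x - 1)^-1 - x^-1 = (x * (x - 1))^-1 by field; rewrite !lt0r_neq0.
have x01 : 0 < x * (x - 1) by exact: mulr_gt0.
rewrite ler_pdivrMr ?exprn_gt0 // mulrAC ler_pdivlMr //.
have xx : 0 < x * x by exact: mulr_gt0.
have -> : 3 * x ^+ 4 = 3 * (x * x) * (x * x) by ring.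
have h1 : 2 * x + 1 <= 3 * (x * x) by nra.
have h2 : x * (x - 1) <= x * x by nra.
by apply: ler_pM => //; lra.
Qed.

Lemma sum_layers_le (R : realType) (m : nat) : (8 <= m)%N ->
  \sum_(8 <= z < m) (2 * z%:R + 1) / z%:R ^+ 4 <= 1 :> R.
Proof.
move=> m8; pose f (z : nat) : R := - (3 * (z%:R - 1)^-1).
apply: (@le_trans _ _ (\sum_(8 <= z < m) (f z.+1 - f z))).
  apply: ler_sum_nat => z /andP[z8 _].
  have zR : 8 <= z%:R :> R by rewrite (ler_nat R 8).
  apply: le_trans (layer_term_le zR) _.
  by rewrite /f -[z.+1%:R]natr1 addrK; lra.
rewrite telescope_sumr // /f.
have mR : 8 <= m%:R :> R by rewrite (ler_nat R 8).
have : 0 <= (m%:R - 1)^-1 :> R by rewrite invr_ge0; lra.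
have -> : (8%:R : R) - 1 = 7 by lra.
lra.
Qed.

Lemma union_bound2 d (T : measurableType d) (R : realType) (P : probability T R)
    (A B : set T) (a b : R) :
    measurable A /\ (P A <= a%:E)%E -> measurable B /\ (P B <= b%:E)%E ->
  measurable (A `|` B) /\ (P (A `|` B) <= (a + b)%:E)%E.
Proof.
move=> [mA PA] [mB PB]; split; first exact: measurableU.
rewrite EFinD; apply: (@le_trans _ _ (P A + P B)%E); first exact: measureU2.
exact: leeD.
Qed.

(** * Scales, failure event and expected ratio *)

Section FixedSize.
Context (n : nat) (d : measure_display) (T : measurableType d) (R : realType)
  (P : probability T R) (p : R) (p01 : 0 <= p <= 1)
  (X : 'I_n * 'I_n -> {RV P >-> bool}) (W : 'I_n * 'I_n -> {RV P >-> R})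
  (model : er_exp_model p X W).

Local Notation L := (ln n%:R : R).
Context (L_ge : 768 <= L) (p_ge : 9 * L <= p * n%:R).

Let n0 : (0 < n)%N.
Proof.
by rewrite lt0n; apply/eqP => n0; have := L_ge; rewrite n0 ln0 //; lra.
Qed.

Let nR : 0 < n%:R :> R. Proof. by rewrite ltr0n. Qed.

Let eL : expR L = n%:R. Proof. by rewrite lnK. Qed.

Let p0 : 0 < p.
Proof. by rewrite -(pmulr_lgt0 _ nR); have := p_ge; have := L_ge; lra. Qed.

Let np0 : 0 < n%:R * p. Proof. exact: mulr_gt0. Qed.

(** exp L >= (L / 4)^4 = L^3 * (L / 256), which is where 768 = 3 * 256 comes from. *)
Let n_ge : 3 * L ^+ 3 <= n%:R.
Proof.
have L1 := L_ge.
have h : L / 4 <= expR (L / 4) by apply: le_trans (expR_ge1Dx _); lra.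
rewrite -[leRHS]eL -[X in expR X](_ : (L / 4) * 4%:R = L); last by field.
rewrite expRM_natr; apply: (@le_trans _ _ ((L / 4) ^+ 4)); last first.
  by apply: lerXn2r; rewrite ?nnegrE ?expR_ge0 //; lra.
have -> : (L / 4) ^+ 4 = L ^+ 3 * (L / 256) by field.
rewrite [leLHS]mulrC; apply: ler_wpM2l; [apply: exprn_ge0|]; lra.
Qed.

(* The constants are such that weight thresholds stay below [8], where
   [1 - exp (- h) >= h / 9] ([one_sub_expR_ge]): [180 / 9 = 20] is the density
   needed in [prob_stage_failure], and [72 / 9 = 8] the one needed in
   [prob_terminal_failure]. *)
Definition radius (z : nat) : R := 180 * z%:R ^+ 2 / (n%:R * p).

Definition top_radius : R := 72 * L / (n%:R * p).

(** With np >= 9 L, z^2 <= 2 L / 5 is what keeps [radius z] at most 180 * (2 / 5) / 9 = 8. *)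
Definition top_scale : nat := Num.truncn (Num.sqrt (2 / 5 * L)).

Lemma top_scale_le : top_scale%:R ^+ 2 <= 2 / 5 * L.
Proof.
rewrite -[leRHS]sqr_sqrtr; last by have := L_ge; lra.
apply: lerXn2r; rewrite ?nnegrE ?sqrtr_ge0 //.
by rewrite truncn_le sqrtr_ge0.
Qed.

Lemma top_scale_gt : 2 / 5 * L < (top_scale%:R + 1) ^+ 2.
Proof.
rewrite -[ltLHS]sqr_sqrtr; last by have := L_ge; lra.
apply: ltrXn2r => //; rewrite ?nnegrE ?sqrtr_ge0 //.
by rewrite natr1 truncnS_gt.
Qed.

Lemma top_scale_ge8 : (8 <= top_scale)%N.
Proof.
rewrite leqNgt; apply/negP => h.
have : top_scale%:R <= 7 :> R by rewrite (ler_nat R _ 7).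
have := top_scale_gt; have := L_ge; have : 0 <= top_scale%:R :> R by [].
set z := top_scale%:R; rewrite expr2 => *; nra.
Qed.


Let scale_sqr z : (z <= top_scale)%N -> z%:R ^+ 2 <= 2 / 5 * L.
Proof.
move=> zZ; apply: le_trans top_scale_le.
by apply: lerXn2r; rewrite ?nnegrE // ler_nat.
Qed.

Let scale_pow4 z : (z <= top_scale)%N -> 3 * L * z%:R ^+ 4 <= n%:R.
Proof.
move=> /scale_sqr h; have L1 := L_ge; apply: le_trans n_ge.
have -> : (z%:R : R) ^+ 4 = z%:R ^+ 2 * z%:R ^+ 2 by ring.
have z0 : 0 <= z%:R ^+ 2 :> R by rewrite exprn_ge0.
set x := z%:R ^+ 2 in h z0 *; rewrite !exprS expr0 mulr1.
have h2 : x * x <= L * L by nra.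
have -> : 3 * L * (x * x) = (3 * (x * x)) * L by ring.
have -> : 3 * (L * (L * L)) = (3 * (L * L)) * L by ring.
by apply: ler_wpM2r; lra.
Qed.

Let scale_leq z : (z <= top_scale)%N -> (z ^ 4 <= n)%N.
Proof.
move=> /scale_pow4 h; rewrite -(ler_nat R) natrX; apply: le_trans h.
have L1 := L_ge; rewrite -[leLHS]mul1r; apply: ler_wpM2r; [exact: exprn_ge0|lra].
Qed.

Let radius_bounds z : (8 <= z)%N -> (z <= top_scale)%N -> 0 < radius z <= 8.
Proof.
move=> z8 /scale_sqr h; rewrite /radius; apply/andP; split.
  apply: divr_gt0 np0; apply: mulr_gt0; first lra.
  by rewrite exprn_gt0 // ltr0n (leq_trans _ z8).
have L1 := L_ge; have pL := p_ge.
by rewrite ler_pdivrMr // [n%:R * p]mulrC; lra.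
Qed.

Let top_radius_bounds : 0 < top_radius <= 8.
Proof.
have L1 := L_ge; have pL := p_ge.
rewrite /top_radius; apply/andP; split; first by rewrite divr_gt0 //; lra.
by rewrite ler_pdivrMr // [n%:R * p]mulrC; lra.
Qed.

Definition failure : set T :=
  ((\bigcup_(z in [set` [pred z : 'I_top_scale.+1 | (8 <= z)%N]])
     stage_failure X W (radius z) z) `|`
   terminal_failure X W top_radius) `|`
  many_light X W (light_threshold n p) (n %/ 8).+1.

(** Each stage fails with probability at most 4 / n^3 and there are at most L of them, giving 1 / n;
    the doubling phase adds 2 / n and the light edges 1 / n. *)
Lemma prob_failure : measurable failure /\ (P failure <= (4 / n%:R)%:E)%E.
Proof.
have L1 := L_ge; have pL := p_ge.
have stage (z : 'I_top_scale.+1) : (8 <= z)%N ->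
    measurable (stage_failure X W (radius z) z) /\
    (P (stage_failure X W (radius z) z) <= (4 * expR (- (3 * L)))%:E)%E.
  move=> z8; have zZ : (z <= top_scale)%N by rewrite -ltnS.
  apply: (prob_stage_failure p01 model z8 (scale_leq zZ) _ (scale_pow4 zZ)).
  - lra.
  - exact: radius_bounds.
  rewrite /radius le_eqVlt; apply/orP; left; apply/eqP; field.
  by rewrite !lt0r_neq0.
have [||||m1 P1] := @union_bound _ _ _ P _ [pred z : 'I_top_scale.+1 | (8 <= z)%N]
    (fun z => stage_failure X W (radius z) z) (4 * expR (- (3 * L))) top_scale.+1.
- by move=> z /stage[].
- by move=> z /stage[].
- by apply: (leq_trans (max_card _)); rewrite card_ord.
- by rewrite mulr_ge0 // expR_ge0.
have [||m2 P2] := prob_terminal_failure p01 model _ top_radius_bounds; first lra.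
  rewrite /top_radius le_eqVlt; apply/orP; left; apply/eqP; field.
  by rewrite !lt0r_neq0.
have [mF PF] := union_bound2 (union_bound2 (conj m1 P1) (conj m2 P2))
  (prob_light_failure p01 model n0 p0).
split=> //; apply: le_trans PF _.
rewrite lee_fin.
have e1 : expR (- (n%:R / 8)) <= 1 / n%:R :> R.
  rewrite div1r -eL -expRN eL ler_expR; have := n_ge; rewrite !exprS expr0 mulr1 => h.
  have : 1 <= L * L by nra.
  have : 8 * L <= 3 * (L * (L * L)) by nra.
  lra.
have e2 : top_scale.+1%:R <= L.
  have h := top_scale_le; rewrite expr2 in h.
  have t8 : 8 <= top_scale%:R :> R by rewrite (ler_nat R 8) top_scale_ge8.
  by rewrite -natr1; nra.
have e3 : 4 * L <= n%:R ^+ 2.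
  have h : L <= n%:R by have := expR_ge1Dx L; rewrite eL; lra.
  by rewrite expr2; nra.
have -> : expR (- (3 * L)) = (n%:R ^+ 3)^-1 :> R by rewrite expRN mulrC expRM_natr eL.
have e4 : top_scale.+1%:R * (4 * (n%:R ^+ 3)^-1) <= 1 / n%:R :> R.
  rewrite mulrA ler_pdivrMr ?exprn_gt0 //.
  have -> : 1 / n%:R * n%:R ^+ 3 = n%:R ^+ 2 :> R by field; rewrite lt0r_neq0.
  by apply: le_trans e3; rewrite mulrC ler_pM2l.
lra.
Qed.

Section GoodOutcome.
Context (t : T) (t_pos : ~ nonpos_weight W t) (t_good : ~ failure t).

Local Notation E := (edges_of X t).
Local Notation w := (fun e => W e t).

Lemma weights_ge0 e : e \in E -> 0 <= W e t.
Proof.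
rewrite inE => /andP[ep _]; rewrite leNgt; apply/negP => h; apply: t_pos.
by exists e => //=; rewrite in_itv /= ltW.
Qed.

Let dist_le h i u v : 0 <= h -> walk_le (light E w h) i u v ->
  (sp_dist E w u v <= (i%:R * h)%:E)%E.
Proof. exact: walk_le_dist weights_ge0 _ _ _ _. Qed.

(** Twice the smallest block would contain two vertices within 7 light edges, and that block has at
    most 2 n / z^4 elements. *)
Lemma separated_card_le z (S : {set 'I_n}) : (8 <= z <= top_scale)%N ->
    (forall u v, u \in S -> v \in S -> u != v ->
      ((7 * radius z)%:E < sp_dist E w u v)%E) ->
  #|S|%:R <= 4 * n%:R / z%:R ^+ 4 :> R.
Proof.
move=> /andP[z8 zZ] sep.
have z4 := scale_leq zZ.
have zn j : (j < 4)%N -> (block n z j <= n)%N.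
  move=> j4; apply: (block_leq R z8); apply: leq_trans z4.
  by rewrite leq_exp2l //; apply: leq_trans z8.
have lk (i : 'I_4) : linked (light E w (radius z)) (block n z i) (coblock n z i).
  apply: linkedP => h; apply: t_good; left; left.
  have zZ' : (z < top_scale.+1)%N by rewrite ltnS.
  by exists (Ordinal zZ') => //; exists i.
have h0 : 0 <= radius z by have /andP[/ltW] := radius_bounds z8 zZ.
have S2 : (#|S| < (block n z 3).*2)%N.
  rewrite ltnNge; apply/negP => hS.
  have [u [v [uS vS uv /(dist_le h0)]]] := linked_chain_separated (zn 0%N isT)
    (zn 1%N isT) (zn 2%N isT) (lk (@Ordinal 4 0 isT)) (lk (@Ordinal 4 1 isT))
    (lk (@Ordinal 4 2 isT)) (lk (@Ordinal 4 3 isT)) hS.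
  by rewrite leNgt sep.
have z0 : 0 < (z%:R : R) ^+ 4 by rewrite exprn_gt0 // ltr0n (leq_trans _ z8).
rewrite ler_pdivlMr //.
have := block_le R (z := z) (i := 3) z4.
have : #|S|%:R <= 2 * (block n z 3)%:R :> R.
  by rewrite -(natrM R 2) mul2n ler_nat ltnW.
nra.
Qed.

(** The walk length of [linked_doubling] for some D > 2 L: as 2 >= exp (1/2), 2^D is at least exp L
    = n. *)
Definition top_steps : nat := (Num.truncn (2 * L)).+1.*2.+1.

Lemma diameter_le u v : (sp_dist E w u v <= (top_steps%:R * top_radius)%:E)%E.
Proof.
have L1 := L_ge; apply: dist_le; first by have /andP[/ltW] := top_radius_bounds.
apply: (@linked_doubling _ _ (terminal_size n)).
- by apply: linkedP => h; apply: t_good; left; right; right.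
- move=> k /andP[k0 km]; apply: linkedP => h; apply: t_good; left; right; left.
  by exists (Ordinal km).
apply: (@leq_trans n); first by rewrite /terminal_size ltn_Pdiv.
rewrite -(ler_nat R) natrX -[leLHS]eL.
have h : 2 * L <= (Num.truncn (2 * L)).+1%:R by rewrite ltW // truncnS_gt.
have e2 : expR (2^-1) <= 2 :> R.
  rewrite -[leRHS]invrK -[leLHS]invrK -expRN lef_pV2 ?posrE ?expR_gt0 //.
  by apply: le_trans (expR_ge1Dx _); lra.
apply: (@le_trans _ _ (expR (2^-1) ^+ (Num.truncn (2 * L)).+1)).
  by rewrite -expRM_natr ler_expR; lra.
by apply: lerXn2r; rewrite ?nnegrE ?expR_ge0.
Qed.

Lemma greedy_cost_le M : greedy_matching (sp_dist E w) M ->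
  (matching_cost (sp_dist E w) M <= (190 * 1000 / p)%:E)%E.
Proof.
move=> [gM pM]; have L1 := L_ge.
pose r z := 7 * radius z.
pose c z := 4 * n%:R / z%:R ^+ 4 : R.
have r_mono z : r z <= r z.+1.
  rewrite /r /radius ler_pM2l; last lra.
  rewrite ler_pM2r; last by rewrite invr_gt0.
  rewrite ler_pM2l; last lra.
  by apply: lerXn2r; rewrite ?nnegrE // ler_nat.
have top0 : 0 <= top_radius by have /andP[/ltW] := top_radius_bounds.
have r0 : 0 <= r 8%N 
  by apply: mulr_ge0; [lra|apply: divr_ge0 (ltW np0); apply: mulr_ge0; [lra|exact: exprn_ge0]].
have tE : (8 + (top_scale - 8))%N = top_scale by rewrite subnKC // top_scale_ge8.
have := @greedy_layer_cake R n (sp_dist E w) M r c (top_steps%:R * top_radius) 8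
  (top_scale - 8) (sp_dist_ge0 weights_ge0) (sp_dist_sym weights_ge0) r_mono r0
  (mulr_ge0 (ler0n _ _) top0) diameter_le.
rewrite tE => /(_ (fun z S h => @separated_card_le z S h) gM) h.
apply: (le_trans h); rewrite lee_fin; clear h.
have t8 : 8 <= top_scale%:R :> R by rewrite (ler_nat R 8) top_scale_ge8.
have M2 : #|M|%:R = n%:R / 2 :> R.
  have : #|M|%:R * 2 = n%:R :> R by rewrite -natrM muln2 perfect_matching_card.
  by move=> <-; field.
have h1 : #|M|%:R * r 8%N = 40 * 1008 / p.
  rewrite M2 /r /radius; have -> : (8%:R : R) ^+ 2 = 64 by rewrite -natrX.
  by field; rewrite !lt0r_neq0.
have h2 : top_steps%:R * top_radius * c top_scale <= 144 * 1000 / p.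
  have s5 : top_steps%:R <= 5 * L.
    have h2 : (Num.truncn (2 * L))%:R <= 2 * L by rewrite truncn_le; lra.
    have -> : top_steps%:R = 2 * (Num.truncn (2 * L))%:R + 3 :> R.
      by rewrite /top_steps -mul2n -addn1 natrD natrM -addn1 natrD; ring.
    lra.
  (* From 2 L / 5 < (Z + 1)^2 <= 4 Z^2, where Z is [top_scale]. *)
  have Z2 : L / 10 <= top_scale%:R ^+ 2.
    by have := top_scale_gt; rewrite expr2; rewrite expr2; nra.
  have Z4 : L ^+ 2 / 100 <= top_scale%:R ^+ 4.
    have -> : (top_scale%:R : R) ^+ 4 = top_scale%:R ^+ 2 * top_scale%:R ^+ 2 by ring.
    by rewrite expr2; nra.
  have Zp : 0 < (top_scale%:R : R) ^+ 4 by rewrite exprn_gt0 //; lra.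
  have -> : top_steps%:R * top_radius * c top_scale =
      top_steps%:R * L * 288 / top_scale%:R ^+ 4 / p.
    by rewrite /top_radius /c; field; rewrite !lt0r_neq0 //; lra.
  rewrite ler_pM2r ?invr_gt0 // ler_pdivrMr //.
  have h3 : top_steps%:R * L <= 5 * L ^+ 2 by rewrite expr2; nra.
  lra.
have h3 : \sum_(8 <= z < top_scale) (r z.+1 - r z) * c z <= 5 * 1008 / p.
  clear h1 h2; set u := 5 * 1008 / p.
  have u0 : 0 <= u by apply: divr_ge0 (ltW p0); lra.
  rewrite (eq_big_nat _ _ (F2 := fun z => u * ((2 * z%:R + 1) / z%:R ^+ 4))); last first.
    move=> z /andP[z8 _].
    have zn0 : (z%:R : R) != 0 by rewrite pnatr_eq0 -lt0n (leq_trans _ z8).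
    rewrite /u /r /radius /c -[z.+1%:R]natr1; field.
    by rewrite zn0 !lt0r_neq0.
  by rewrite -mulr_sumr -[leRHS]mulr1 ler_wpM2l // sum_layers_le // top_scale_ge8.
(* Edges up to [r 8], the layers, and the edges beyond the last layer; the rest rounds the constant
   up. *)
have -> : 190 * 1000 / p = 40 * 1008 / p + 5 * 1008 / p + 144 * 1000 / p + 640 / p.
  by field; rewrite lt0r_neq0.
have : 0 <= 640 / p by apply: divr_ge0 (ltW p0); lra.
lra.
Qed.

Lemma good_min_matching_cost_ge :
  ((expR (- 2) / (32 * p))%:E <= min_matching_cost (sp_dist E w))%E.
Proof.
have -> : expR (- 2) / (32 * p) = light_threshold n p * (n%:R / 4).
  by rewrite /light_threshold; field; rewrite !lt0r_neq0.
apply: (min_matching_cost_ge weights_ge0).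
  by rewrite /light_threshold divr_ge0 ?expR_ge0 // ltW // !mulr_gt0.
by apply: many_lightP => // h; apply: t_good; right.
Qed.

End GoodOutcome.

Lemma approx_ratio_integral_le (greedy : T -> {set 'I_n * 'I_n}) :
    (forall t, greedy_matching (random_sp_metric X W t) (greedy t)) ->
  (\int[P]_t approx_ratio (matching_cost (random_sp_metric X W t) (greedy t))
      (min_matching_cost (random_sp_metric X W t)) <=
    (32 * (190 * 1000) * expR 2 + 12)%:E)%E.
Proof.
move=> gr; have L1 := L_ge.
pose b : R := expR (- 2) / (32 * p).
have b0 : 0 < b by apply: divr_gt0; rewrite ?expR_gt0 // mulr_gt0.
pose a : R := 190 * 1000 / p.
have a0 : 0 <= a by apply: divr_ge0 (ltW p0); lra.
have K0 : 0 <= a / b by rewrite divr_ge0 // ltW.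
(* Both costs are of order 1 / p, so [p] cancels. *)
have KE : 32 * (190 * 1000) * expR 2 = a / b.
  by rewrite /a /b expRN; field; rewrite !lt0r_neq0 ?expR_gt0.
have costs t : ~ nonpos_weight W t -> ~ failure t ->
    (matching_cost (random_sp_metric X W t) (greedy t) <= a%:E)%E /\
    (b%:E <= min_matching_cost (random_sp_metric X W t))%E.
  by move=> tN tF; split; [exact: greedy_cost_le (gr t)|exact: good_min_matching_cost_ge].
rewrite KE; clearbody a b; clear KE; set K := a / b in K0 *.
have [mN PN] := nonpos_weight_null model.
have [mF PF] := prob_failure.
(* The majorant pays [K] always, a further n + 2 on failure by [greedy_le_opt], and infinity on the
   null event. *)
pose g t := (K%:E + n.+2%:R%:E * (\1_failure t)%:E + +oo * (\1_(nonpos_weight W) t)%:E)%E.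
apply: (@le_trans _ _ (\int[P]_t g t)%E).
  have g1 t : (0 <= K%:E + n.+2%:R%:E * (\1_failure t)%:E)%E.
    by rewrite -EFinM -EFinD lee_fin addr_ge0 // mulr_ge0.
  have g2 t : (0 <= +oo * (\1_(nonpos_weight W) t)%:E :> \bar R)%E.
    by rewrite mule_ge0 // lee_fin.
  apply: integral_le_majorant => t; first exact: adde_ge0.
  rewrite /g; have [tN|tN] := pselect (nonpos_weight W t).
    rewrite [\1_(nonpos_weight W) t]indicE mem_set // mule1 addey ?leey //.
  rewrite [\1_(nonpos_weight W) t]indicE memNset // mule0 adde0.
  have w0 := weights_ge0 tN.
  have [gM pM] := gr t.
  have [tF|tF] := pselect (failure t).
    apply: (@le_trans _ _ n.+2%:R%:E).
      apply: approx_ratio_le_greedy; first by rewrite ler1n.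
      - exact: min_matching_cost_ge0 (sp_dist_ge0 w0).
      - exact: min_matching_cost_le.
      by apply: greedy_le_opt (gr t); [exact: sp_dist_ge0|exact: sp_dist_refl|
        exact: sp_dist_sym|move=> *; exact: sp_dist_tri].
    by rewrite indicE mem_set // mule1 -EFinD lee_fin lerDr.
  rewrite indicE memNset // mule0 adde0.
  have [ha hb] := costs t tN tF.
  by apply: approx_ratio_le => //; exact: matching_cost_ge0 (sp_dist_ge0 w0) _.
have mind (A : set T) : measurable A -> measurable_fun setT (fun t => (\1_A t)%:E : \bar R).
  by move=> mA; apply/measurable_EFinP; exact: measurable_indic.
have indic0 (A : set T) t : (0 <= (\1_A t)%:E :> \bar R)%E by rewrite lee_fin.
have integralI (A : set T) (k : \bar R) : measurable A -> (0 <= k)%E ->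
    (\int[P]_t (k * (\1_A t)%:E) = k * P A)%E.
  move=> mA k0; rewrite ge0_integralZl //; last exact: mind.
  by rewrite integral_indic // setIT.
have n2 : (0 <= n.+2%:R%:E :> \bar R)%E by rewrite lee_fin.
have mk (A : set T) (k : \bar R) : measurable A ->
    measurable_fun setT (fun t => k * (\1_A t)%:E)%E.
  by move=> mA; apply: measurable_funeM; exact: mind.
rewrite /g ge0_integralD //; first last.
- exact: mk.
- by apply: emeasurable_funD; [exact: measurable_cst|exact: mk].
- by move=> t _; rewrite adde_ge0 ?lee_fin // mule_ge0.
rewrite ge0_integralD //; last exact: mk.
have intK : (\int[P]_t K%:E = K%:E * P setT)%E by exact: integral_cst.
rewrite intK probability_setT mule1 !integralI // PN mule0 adde0.
apply: (@le_trans _ _ (K%:E + n.+2%:R%:E * (4 / n%:R)%:E)%E).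
  by apply: leeD2l; apply: lee_wpmul2l.
(* The failure term (n + 2) * 4 / n is at most 12. *)
rewrite -EFinM -EFinD lee_fin lerD2l mulrA ler_pdivrMr //.
have : n.+2%:R = n%:R + 2 :> R by rewrite -addn2 natrD.
move=> ->; have : L <= n%:R by have := expR_ge1Dx L; rewrite eL; lra.
lra.
Qed.

End FixedSize.

(** * The asymptotic statement *)

Unset Implicit Arguments.

Theorem theorem8 (R : realType) (eps c : R) (p : nat -> R)
    (d : nat -> measure_display) (T : forall n : nat, measurableType (d n))
    (P : forall n : nat, probability (T n) R)
    (X : forall n : nat, 'I_n * 'I_n -> {RV (P n) >-> bool})
    (W : forall n : nat, 'I_n * 'I_n -> {RV (P n) >-> R})
    (greedy : forall n : nat, T n -> {set 'I_n * 'I_n}) :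
  0 < eps < 1 ->
  9 / eps ^+ 2 < c ->
  (forall n : nat, 0 <= p n <= 1) ->
  (\forall n \near \oo, c * ln n%:R / n%:R <= p n) ->
  (forall n : nat, er_exp_model (p n) (X n) (W n)) ->
  (forall (n : nat) (M : {set 'I_n * 'I_n}),
     measurable [set t | greedy n t = M]) ->
  (forall (n : nat) (t : T n), ~~ odd n ->
     greedy_matching (random_sp_metric (X n) (W n) t) (greedy n t)) ->
  exists C : R, \forall n \near \oo, ~~ odd n ->
    (\int[P n]_t approx_ratio
       (matching_cost (random_sp_metric (X n) (W n) t) (greedy n t))
       (min_matching_cost (random_sp_metric (X n) (W n) t)) <= C%:E)%E.
Proof.
move=> /andP[e0 e1] ce p01 pn model _ gr.
(* Since eps < 1, 9 / eps^2 exceeds 9; this yields n p >= 9 ln n. *)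
have c9 : 9 <= c.
  apply: le_trans (ltW ce); rewrite ler_pdivlMr ?exprn_gt0 // -[leRHS]mulr1.
  by rewrite ler_pM2l // expr_le1 // ltW.
exists (32 * (190 * 1000) * expR 2 + 12).
near=> n => even_n.
have n_exp : expR 768 <= n%:R :> R.
  apply: (@le_trans _ _ (Num.truncn (expR 768 : R)).+1%:R).
    by rewrite ltW // truncnS_gt.
  by rewrite ler_nat; near: n; exact: nbhs_infty_ge.
have n0 : 0 < n%:R :> R by apply: lt_le_trans n_exp; exact: expR_gt0.
have L_ge : 768 <= ln n%:R :> R.
  by rewrite -[leLHS]expRK ler_ln ?posrE ?expR_gt0.
apply: (approx_ratio_integral_le (p01 n) (model n) L_ge).
  have : c * ln n%:R / n%:R <= p n by near: n.
  rewrite ler_pdivrMr //; apply: le_trans.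
  by apply: ler_wpM2r => //; lra.
by move=> t; exact: gr.
Unshelve. all: by end_near. Qed.
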